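(* Let $A$ generate a uniformly bounded $C_0$-semigroup $(S(t))_{t\ge0}$ on a Hilbert space $H$. Fix $T>0$, let $f\in L^1_{\#}(0,T;H)$, and set $V:=S(T)$ and $b:=\int_0^TS(T-s)f(s)\,ds$. For $n\ge1$ let $S_n^V:=\sum_{k=0}^{n-1}V^k$. Then the following are equivalent: (i) $\dot u=Au+f$ has no $T$-periodic mild solution; (ii) every mild solution of $\dot u=Au+f$ is unbounded on $[0,\infty)$; (iii) some mild solution of $\dot u=Au+f$ is unbounded on $[0,\infty)$; (iv) $b\notin\mathcal R(I-V)$ (the range of $I-V$); (v) $\sup_{n\ge1}\|S_n^Vb\|_H=\infty$. In particular, $(T,f)$ is a statically resonant pair if and only if it is a secularly resonant pair.
   Context: $L^1_{\#}(0,T;H)$ denotes functions in $L^1(0,T;H)$ extended to $\mathbb R$ by $T$-periodicity. A mild solution of $\dot u=Au+f$ is a function $u(t)=S(t)u_0+\int_0^tS(t-s)f(s)\,ds\in C([0,\infty);H)$ with $u_0\in H$. Uniformly bounded means $\|S(t)\|_{\mathcal L(H)}\le M$ for all $t\ge0$. The pair $(T,f)$ is statically resonant if $\dot u=Au+f$ admits no $T$-periodic mild solution, and secularly resonant if some mild solution satisfies $\sup_{t\ge0}\|u(t)\|_H=\infty$. *)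

(* Defs.v *)
From HB Require Import structures.
From mathcomp Require Import all_boot all_order all_algebra.
From mathcomp Require Import sesquilinear complex.
From mathcomp Require Import all_classical all_reals all_analysis.

Set Implicit Arguments.
Unset Strict Implicit.
Unset Printing Implicit Defensive.

Import Order.TTheory GRing.Theory Num.Theory.
Import numFieldNormedType.Exports.

Local Open Scope classical_set_scope.
Local Open Scope ring_scope.

(* Hilbert spaces are taken over the reals or over the complex numbers; time
   is always real, so [of_real] and [to_real] connect R with the scalars. *)
Variant scalar_kind := RealScalars | ComplexScalars.

Definition scalars (R : realType) (k : scalar_kind) : numFieldType :=
  match k with
  | RealScalars => R
  | ComplexScalars => complex R
  end.

Definition of_real (R : realType) (k : scalar_kind) : R -> scalars R k :=
  match k return R -> scalars R k with
  | RealScalars => fun x => x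
  | ComplexScalars => fun x => real_complex R x
  end.

Definition to_real (R : realType) (k : scalar_kind) : scalars R k -> R :=
  match k return scalars R k -> R with
  | RealScalars => fun x => x
  | ComplexScalars => fun z => complex.Re z
  end.

Definition conj_scalar (R : realType) (k : scalar_kind) :
    scalars R k -> scalars R k :=
  match k return scalars R k -> scalars R k with
  | RealScalars => fun x => x
  | ComplexScalars => fun z => conjc z
  end.

(* The library norm takes its values in the scalar field; [rnorm] is the same
   number seen in R. *)
Definition rnorm (R : realType) (k : scalar_kind)
    (H : normedModType (scalars R k)) (x : H) : R := to_real `|x|.

Definition real_scale (R : realType) (k : scalar_kind)
    (H : normedModType (scalars R k)) (r : R) (x : H) : H := of_real k r *: x.

Section Bochner.
Context (R : realType) (k : scalar_kind) (H : normedModType (scalars R k)).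
Local Notation mu := (@lebesgue_measure R).

Definition simple_function (s : R -> H) : Prop :=
  finite_set (range s) /\ forall v : H, measurable (s @^-1` [set v]).

(* Only meaningful for D of finite measure, where [fine] loses nothing. *)
Definition simple_integral (D : set R) (s : R -> H) : H :=
  \sum_(v \in range s) real_scale (fine (mu (D `&` s @^-1` [set v]))) v.

Definition simple_approximation (D : set R) (f : R -> H) (s : (R -> H)^nat) :
    Prop :=
  (forall n, simple_function (s n)) /\
  {ae mu, forall x, D x -> s n x @[n --> \oo] --> f x}.

Definition strongly_measurable (D : set R) (f : R -> H) : Prop :=
  exists s : (R -> H)^nat, simple_approximation D f s.

Definition L1 (D : set R) (f : R -> H) : Prop :=
  strongly_measurable D f /\ (\int[mu]_(x in D) (rnorm (f x))%:E < +oo)%E.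

Definition is_bochner_integral (D : set R) (f : R -> H) (v : H) : Prop :=
  exists s : (R -> H)^nat,
    [/\ simple_approximation D f s,
        (\int[mu]_(x in D) (rnorm (f x - s n x))%:E)%E @[n --> \oo] --> 0%E &
        simple_integral D (s n) @[n --> \oo] --> v].

(* Takes the junk value 0 when f is not Bochner integrable on D. *)
Definition bochner_integral (D : set R) (f : R -> H) : H :=
  xget 0 [set v | is_bochner_integral D f v].

Definition L1_periodic (T : R) (f : R -> H) : Prop :=
  L1 `[0, T] f /\ forall t, f (t + T) = f t.

End Bochner.

Section Semigroup.
Context (R : realType) (k : scalar_kind) (H : normedModType (scalars R k)).

(* The values S t for t < 0 are unconstrained and never used. *)
Record C0_semigroup (S : R -> H -> H) : Prop := {
  C0_linear : forall t : R, 0 <= t -> linear (S t);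
  C0_continuous : forall t : R, 0 <= t -> continuous (S t);
  C0_id : forall x : H, S 0 x = x;
  C0_add : forall (s t : R) (x : H), 0 <= s -> 0 <= t -> S (s + t) x = S s (S t x);
  C0_strong : forall x : H, S t x @[t --> 0^'+] --> x
}.

(* The unbounded operator A is given by its domain D and a total function
   whose values outside D are irrelevant. *)
Definition generator (S : R -> H -> H) (D : set H) (A : H -> H) : Prop :=
  forall x y : H,
    (D x /\ A x = y) <->
    (real_scale h^-1 (S h x - x) @[h --> 0^'+] --> y).

Definition uniformly_bounded (S : R -> H -> H) : Prop :=
  exists M : R, forall t : R, 0 <= t -> forall x, rnorm (S t x) <= M * rnorm x.

(* A mild solution lives on [0, +oo[; the values u t for t < 0 are ignored
   here and in every predicate below. *)
Definition mild_solution (S : R -> H -> H) (f u : R -> H) : Prop :=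
  {within `[0, +oo[, continuous u} /\
  exists u0 : H, forall t : R, 0 <= t ->
    u t = S t u0 + bochner_integral `[0, t] (fun s => S (t - s) (f s)).

Definition periodic_on_halfline (T : R) (u : R -> H) : Prop :=
  forall t : R, 0 <= t -> u (t + T) = u t.

Definition unbounded_on_halfline (u : R -> H) : Prop :=
  ereal_sup [set (rnorm (u t))%:E | t in `[0, +oo[] = +oo%E.

Definition statically_resonant (S : R -> H -> H) (T : R) (f : R -> H) : Prop :=
  ~ exists u, mild_solution S f u /\ periodic_on_halfline T u.

Definition secularly_resonant (S : R -> H -> H) (f : R -> H) : Prop :=
  exists u, mild_solution S f u /\ unbounded_on_halfline u.

Definition power_sum (V : H -> H) (n : nat) (x : H) : H :=
  \sum_(0 <= j < n) iter j V x.

End Semigroup.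

(* Main.v *)
Require Import Defs.
From HB Require Import structures.
From mathcomp Require Import all_boot all_order all_algebra.
From mathcomp Require Import sesquilinear complex.
From mathcomp Require Import all_classical all_reals all_analysis.
From mathcomp Require Import finmap measurable_realfun ring lra.

Set Implicit Arguments.
Unset Strict Implicit.
Unset Printing Implicit Defensive.

Import Order.TTheory GRing.Theory Num.Theory.
Import numFieldNormedType.Exports.

Local Open Scope classical_set_scope.
Local Open Scope ring_scope.

(** Write V := S T, let F t be the integral of S (t - s) (f s) over [0, t], and
    b := F T.  A mild solution with initial value x is S t x + F t.  Splitting
    the integral at T and using the period gives F (t + T) = S t b + F t
    ([forced_addT]); hence F (n T) is the n-th power sum of V at b, and a mild
    solution at time r + n T, with r in [0, T[, differs by a bounded amount
    from S r applied to that power sum.  Therefore a mild solution is bounded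
    exactly when the power sums of b are, whatever its initial value, and it is
    T-periodic exactly when its initial value x satisfies x - V x = b.

    What remains is the relation between bounded power sums and the range of
    I - V.  If b = x - V x the power sums telescope to x - V^n x.  Conversely
    ([bounded_power_sum_range]), the Cesaro means z of the power sums are
    bounded and satisfy z - V z - b -> 0, so that the closed convex sets
    of the x in a fixed ball with |x - V x - b| <= c / n are nonempty and
    decreasing.  In a Hilbert space such sets have a common point, because
    points of nearly minimal norm form a Cauchy sequence by the parallelogram
    law ([nested_midpoint_convex]); a common point solves x - V x = b.

    The facts on F rest on a description of the Bochner integral by real
    integrals: phi (\int f) = \int phi o f for every bounded real-linear phi
    ([rf_bochner_integral]).  With phi = Re <L x, y> this yields existence and
    uniqueness of the integral, its norm bound, and its compatibility with
    bounded operators, with splitting the domain and with translations, all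
    from the corresponding facts on real Lebesgue integrals.  As simple
    functions are only required to approximate f almost everywhere, f is first
    replaced by a version on [0, +oo[, again T-periodic, which is an everywhere
    limit of simple functions ([periodic_borel_version]). *)

(** * Norms and inner products with real values *)

Section RealNorm.
Context (R : realType) (k : scalar_kind) (H : normedModType (scalars R k)).
Implicit Types (x y : H) (r : R).

Lemma to_realK (a : scalars R k) : 0 <= a -> of_real k (to_real a) = a.
Proof.
by case: k a => //= -[a b]; rewrite lecE /= => /andP[/eqP -> _].
Qed.

Lemma of_realK : cancel (@of_real R k) (@to_real R k).
Proof. by case: k. Qed.

Lemma to_realD : {morph @to_real R k : a b / a + b}.
Proof. by case: k => //= -[a b] [c d]. Qed.

Lemma to_realMl r (a : scalars R k) : to_real (of_real k r * a) = r * to_real a.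
Proof. by case: k a => //= -[a b] /=; rewrite mul0r subr0. Qed.

Lemma of_real_le r s : (of_real k r <= of_real k s) = (r <= s).
Proof. by case: k => //=; rewrite lecR. Qed.

Lemma of_real_lt r s : (of_real k r < of_real k s) = (r < s).
Proof. by case: k => //=; rewrite ltcR. Qed.

Lemma of_realD r s : of_real k (r + s) = of_real k r + of_real k s.
Proof. by case: k => //=; rewrite raddfD. Qed.

Lemma of_realM r s : of_real k (r * s) = of_real k r * of_real k s.
Proof. by case: k => //=; rewrite rmorphM. Qed.

Lemma of_real0 : of_real k 0 = 0 :> scalars R k.
Proof. by case: k. Qed.

Lemma of_real_nat n : of_real k n%:R = n%:R :> scalars R k.
Proof. by case: k => //=; rewrite rmorph_nat. Qed.

Lemma of_real_norm r : `|of_real k r| = of_real k `|r|.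
Proof. by case: k => //=; rewrite normc_def /= expr0n /= addr0 sqrtr_sqr. Qed.

Lemma to_real_conj (a : scalars R k) : to_real (conj_scalar a) = to_real a.
Proof. by case: k a => //= -[]. Qed.

Lemma norm_rnorm x : `|x| = of_real k (rnorm x).
Proof. by rewrite /rnorm to_realK. Qed.

Lemma rnorm_ge0 x : 0 <= rnorm x.
Proof. by rewrite -of_real_le of_real0 -norm_rnorm. Qed.

Lemma rnorm0 : rnorm (0 : H) = 0.
Proof. by rewrite /rnorm normr0 -of_real0 of_realK. Qed.

Lemma rnorm_eq0 x : rnorm x = 0 -> x = 0.
Proof. by move=> x0; apply/normr0_eq0; rewrite norm_rnorm x0 of_real0. Qed.

Lemma rnormN x : rnorm (- x) = rnorm x.
Proof. by rewrite /rnorm normrN. Qed.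

Lemma rnormBC x y : rnorm (x - y) = rnorm (y - x).
Proof. by rewrite -rnormN opprB. Qed.

Lemma rnormD x y : rnorm (x + y) <= rnorm x + rnorm y.
Proof. by rewrite -of_real_le of_realD -!norm_rnorm ler_normD. Qed.

Lemma rnormB x y : rnorm (x - y) <= rnorm x + rnorm y.
Proof. by rewrite -(rnormN y) rnormD. Qed.

Lemma rnorm_distD y x z : rnorm (x - z) <= rnorm (x - y) + rnorm (y - z).
Proof. by have := rnormD (x - y) (y - z); rewrite addrA subrK. Qed.

Lemma rnorm_dist x y : `|rnorm x - rnorm y| <= rnorm (x - y).
Proof.
rewrite ler_norml; apply/andP; split.
  by have := rnormD (y - x) x; rewrite subrK rnormBC; lra.
by have := rnormD (x - y) y; rewrite subrK; lra.
Qed.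

Lemma rnormZ r x : rnorm (real_scale r x) = `|r| * rnorm x.
Proof.
by rewrite /rnorm /real_scale normrZ of_real_norm to_realMl.
Qed.

(** Neighbourhoods in H are given by radii in the scalar field; every later
    limit is reduced to one in R by this equivalence. *)
Lemma rnorm_cvgP (I : Type) (F : set_system I) {FF : Filter F}
    (s : I -> H) (l : H) :
  s @ F --> l <-> (fun n => rnorm (s n - l)) @ F --> 0.
Proof.
split=> [/cvgrPdist_lt sl|/cvgrPdist_lt sl].
  apply/cvgrPdist_lt => e e0.
  have := sl (of_real k e); rewrite -of_real0 of_real_lt => /(_ e0).
  apply: filterS => n; rewrite norm_rnorm of_real_lt sub0r normrN.
  by rewrite ger0_norm ?rnorm_ge0// rnormBC.
apply/cvgrPdist_lt => e e0.
have eE : of_real k (to_real e) = e by rewrite to_realK// ltW.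
have := sl (to_real e); rewrite -of_real_lt of_real0 eE => /(_ e0).
apply: filterS => n; rewrite sub0r normrN ger0_norm ?rnorm_ge0//.
by rewrite rnormBC -of_real_lt eE -norm_rnorm.
Qed.
End RealNorm.

Section RealInner.
Context (R : realType) (k : scalar_kind) (H : normedModType (scalars R k)).
Context (dot : {dot H for @conj_scalar R k}).
Context (dot_norm : forall x : H, dot x x = `|x| ^+ 2).
Implicit Types x y : H.

(** Real part of the inner product: a real inner product with the same norm,
    which lets real and complex scalars be treated together. *)
Definition rdot (x y : H) : R := to_real (dot x y).

Lemma rdotDl y : {morph rdot^~ y : x z / x + z}.
Proof. by move=> x z; rewrite /rdot linearDl to_realD. Qed.

Lemma rdotZl r x y : rdot (real_scale r x) y = r * rdot x y.
Proof. by rewrite /rdot linearZl_LR to_realMl. Qed.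

Lemma rdotC x y : rdot x y = rdot y x.
Proof.
by rewrite /rdot [in LHS]hermitian_subproof expr0 mul1r to_real_conj.
Qed.

Lemma rdotxx x : rdot x x = rnorm x ^+ 2.
Proof.
by rewrite /rdot dot_norm norm_rnorm expr2 -of_realM of_realK expr2.
Qed.

Lemma rnormD_sqr x y :
  rnorm (x + y) ^+ 2 = rnorm x ^+ 2 + rnorm y ^+ 2 + 2 * rdot x y.
Proof.
rewrite -!rdotxx rdotDl !(rdotC _ (x + y)) !rdotDl (rdotC y x).
lra.
Qed.

Lemma real_scaleN1 x : real_scale (-1) x = - x.
Proof.
rewrite /real_scale (_ : of_real k (-1) = -1) ?scaleN1r//.
by case: (k) => //=; rewrite rmorphN1.
Qed.

Lemma rdotNl x y : rdot (- x) y = - rdot x y.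
Proof. by rewrite -real_scaleN1 rdotZl mulN1r. Qed.

Lemma parallelogram x y :
  rnorm (x + y) ^+ 2 + rnorm (x - y) ^+ 2 = 2 * (rnorm x ^+ 2 + rnorm y ^+ 2).
Proof. by rewrite !rnormD_sqr rnormN (rdotC x (- y)) rdotNl (rdotC y); lra. Qed.

(** Here Cauchy-Schwarz follows from the triangle inequality: expand
    |x + y|^2 and |x - y|^2, both at most (|x| + |y|)^2. *)
Lemma rdot_le x y : `|rdot x y| <= rnorm x * rnorm y.
Proof.
have Dx := rnormD x y; have Bx := rnormB x y.
have /= sD : rnorm (x + y) ^+ 2 <= (rnorm x + rnorm y) ^+ 2.
  by rewrite lerXn2r// nnegrE ?addr_ge0// rnorm_ge0.
have /= sB : rnorm (x - y) ^+ 2 <= (rnorm x + rnorm y) ^+ 2.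
  by rewrite lerXn2r// nnegrE ?addr_ge0// rnorm_ge0.
move: sD sB; rewrite !rnormD_sqr rnormN (rdotC x (- y)) rdotNl (rdotC y).
move=> sD sB.
by rewrite ler_norml; apply/andP; split; nra.
Qed.
End RealInner.

(** * Bounded power sums and the range of I - V *)

Section Complete.
Context (R : realType) (k : scalar_kind).
Context (H : completeNormedModType (scalars R k)).

Lemma rnorm_cauchy_cvg (s : nat -> H) (d : nat -> R) :
  d @ \oo --> 0 ->
  (forall n p, (n <= p)%N -> rnorm (s n - s p) <= d n + d p) ->
  exists l : H, s @ \oo --> l.
Proof.
move=> /cvgrPdist_lt d0 sd.
suff : cvg (s @ \oo) by move=> /cvg_ex.
apply: cauchy_cvg; apply/cauchy_exP => e e0.
have eE : of_real k (to_real e) = e by rewrite to_realK// ltW.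
have e2 : 0 < to_real e / 2.
  by rewrite divr_gt0// -(of_real_lt k) of_real0 eE.
have [N _ NP] := d0 _ e2; exists (s N), N => // p /= Np.
rewrite -ball_normE /ball_ /= norm_rnorm -eE of_real_lt.
rewrite (le_lt_trans (sd _ _ Np))//.
have := NP N (leqnn N); have := NP p Np; rewrite /= !sub0r !normrN.
have := ler_norm (d N); have := ler_norm (d p); lra.
Qed.
End Complete.

Section PlainLinear.
Context (K : pzRingType) (U W : lmodType K) (L : U -> W) (linL : linear L).

(** Semigroup operators are linear only in the sense of the predicate
    [linear], without a bundled structure; these lemmas serve such maps. *)
Lemma plain_linearD x y : L (x + y) = L x + L y.
Proof. by have := linL 1 x y; rewrite !scale1r. Qed.

Lemma plain_linear0 : L 0 = 0.
Proof. by apply: (addrI (L 0)); rewrite -plain_linearD !addr0. Qed.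

Lemma plain_linearZ a x : L (a *: x) = a *: L x.
Proof. by have := linL a x 0; rewrite plain_linear0 !addr0. Qed.

Lemma plain_linearB x y : L (x - y) = L x - L y.
Proof. by rewrite plain_linearD -scaleN1r plain_linearZ scaleN1r. Qed.

Lemma plain_linear_sum n (F : nat -> U) :
  L (\sum_(0 <= j < n) F j) = \sum_(0 <= j < n) L (F j).
Proof.
elim: n => [|n IH]; first by rewrite !big_nil plain_linear0.
by rewrite !big_nat_recr//= plain_linearD IH.
Qed.
End PlainLinear.

Section RangeCriterion.
Context (R : realType) (k : scalar_kind).
Context (H : completeNormedModType (scalars R k)).
Context (dot : {dot H for @conj_scalar R k}).
Context (dot_norm : forall x : H, dot x x = `|x| ^+ 2).
Implicit Types x y : H.

(** Stands in for weak compactness of balls.  The minimal norms m n of the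
    sets increase to a limit M.  For n <= p, nearly minimal points s n and s p
    both lie in C n, hence so does their midpoint, whose norm is at least m n;
    the parallelogram law then bounds |s n - s p|^2 by about 4 (M^2 - m n^2). *)
Lemma nested_midpoint_convex (C : nat -> set H) (B : R) :
  (forall n, C n !=set0) ->
  (forall n x, C n x -> rnorm x <= B) ->
  (forall n p, (n <= p)%N -> C p `<=` C n) ->
  (forall n x y, C n x -> C n y -> C n (real_scale 2^-1 (x + y))) ->
  exists (s : nat -> H) (l : H), (forall n, C n (s n)) /\ s @ \oo --> l.
Proof.
move=> C0 CB Cd Cc.
pose m n := inf (@rnorm _ _ _ @` C n).
have lb n : has_inf (@rnorm _ _ _ @` C n).
  split; first by have [x Cx] := C0 n; exists (rnorm x), x.
  by exists 0 => _ [x _ <-]; exact: rnorm_ge0.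
have m_le n x : C n x -> m n <= rnorm x.
  by move=> Cx; apply: ge_inf; [exact: (lb n).2|exists x].
have m_ge0 n : 0 <= m n.
  by apply: lb_le_inf; [exact: (lb n).1|move=> _ [x _ <-]; exact: rnorm_ge0].
have m_nd : nondecreasing_seq m.
  move=> n p np; apply: lb_le_inf; first exact: (lb p).1.
  by move=> _ [x /(Cd _ _ np) Cx <-]; exact: m_le.
have m_ub n : m n <= B.
  by have [x Cx] := C0 n; apply: le_trans (m_le _ _ Cx) (CB _ _ Cx).
have [M mM] : exists M : R, m @ \oo --> M.
  by apply/cvg_ex; apply: nondecreasing_is_cvgn => //; exists B => _ [n _ <-].
have m_M n : m n <= M.
  have := nondecreasing_cvgn_le m_nd; move/cvg_lim: (mM) => <-//.
  by apply; apply/cvg_ex; exists M.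
have e0 n : 0 < n.+1%:R^-1 :> R by rewrite invr_gt0.
have ex n : exists x, C n x /\ rnorm x < m n + n.+1%:R^-1.
  have [_ [x Cx <-] xm] := inf_adherent (e0 n) (lb n).
  by exists x.
have [s sP] := choice ex.
(* The bound given by the parallelogram law; it tends to 0 as m n -> M. *)
pose d n := Num.sqrt (4 * (M + n.+1%:R^-1) ^+ 2 - 4 * m n ^+ 2).
have [l sl] : exists l : H, s @ \oo --> l.
  apply: (@rnorm_cauchy_cvg _ _ _ s d).
    rewrite -[X in _ --> X]sqrtr0.
    apply: continuous_cvg; first exact: sqrt_continuous.
    rewrite (_ : 0 = 4 * (M + 0) ^+ 2 - 4 * M ^+ 2); last first.
      by rewrite addr0 subrr.
    apply: cvgB; apply: cvgMl_tmp.
      rewrite expr2; apply: cvgM; apply: cvgD => //; try exact: cvg_cst.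
        exact: cvg_harmonic.
      exact: cvg_harmonic.
    by rewrite expr2; apply: cvgM.
  move=> n p np; rewrite (@le_trans _ _ (d n)) ?lerDl ?sqrtr_ge0//.
  rewrite -(ger0_norm (rnorm_ge0 _)) -sqrtr_sqr ler_wsqrtr//.
  have [Cn sn] := sP n; have [Cp sp] := sP p.
  have Csum := m_le _ _ (Cc n _ _ Cn (Cd _ _ np _ Cp)).
  rewrite rnormZ ger0_norm ?invr_ge0// in Csum.
  have := parallelogram dot_norm (s n) (s p).
  have ep : p.+1%:R^-1 <= n.+1%:R^-1 :> R by rewrite lef_pV2 ?posrE// ler_nat.
  have Me0 : 0 <= M + n.+1%:R^-1.
    by rewrite addr_ge0 ?(le_trans (m_ge0 n) (m_M n))// ltW.
  have sn' : rnorm (s n) ^+ 2 <= (M + n.+1%:R^-1) ^+ 2.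
    rewrite lerXn2r ?nnegrE ?rnorm_ge0//.
    by rewrite (le_trans (ltW sn))// lerD2r.
  have sp' : rnorm (s p) ^+ 2 <= (M + n.+1%:R^-1) ^+ 2.
    rewrite lerXn2r ?nnegrE ?rnorm_ge0//.
    by rewrite (le_trans (ltW sp))// lerD.
  have : (2 * m n) ^+ 2 <= rnorm (s n + s p) ^+ 2.
    by rewrite lerXn2r ?nnegrE ?rnorm_ge0 ?mulr_ge0//; lra.
  rewrite exprMn; move: sn' sp'.
  move: (rnorm (s n + s p)) (rnorm (s n - s p)) (rnorm (s n)) (rnorm (s p)).
  move: (m n) (M + n.+1%:R^-1) => a1 a2 a3 a4 a5 a6.
  have -> : 2 ^+ 2 = 4 :> R by lra.
  by lra.
by exists s, l; split => // n; case: (sP n).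
Qed.

(** For the Cesaro mean z of the first n power sums, z - V z - b is
    - (1 / n) times the n-th power sum, thus of norm at most B / n.  So the
    sets of approximate solutions in the ball of radius B are nonempty, and
    a common limit point is an exact solution. *)
Lemma bounded_power_sum_range (V : H -> H) (b : H) (B : R) :
  linear V -> continuous V -> (forall n, rnorm (power_sum V n b) <= B) ->
  exists x, x - V x = b.
Proof.
move=> linV contV bdB.
have VD := plain_linearD linV; have VZ := plain_linearZ linV.
have V_sum := plain_linear_sum linV.
have V_psum n : V (power_sum V n b) = power_sum V n.+1 b - b.
  rewrite /power_sum V_sum [in RHS]big_nat_recl//= addrC addKr.
  by apply: eq_bigr.
(* [n.+1] keeps the bound meaningful for n = 0. *)
pose C n := [set x : H | rnorm x <= B /\ rnorm (x - V x - b) <= B * n.+1%:R^-1].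
have B0 : 0 <= B by apply: le_trans (bdB 0); exact: rnorm_ge0.
have [] := @nested_midpoint_convex C B.
- move=> n.
  pose z := real_scale n.+1%:R^-1 (\sum_(0 <= j < n.+1) power_sum V j b).
  exists z; split.
    rewrite rnormZ ger0_norm ?invr_ge0//.
    rewrite ler_pdivrMl ?ltr0n//.
    have : forall m, rnorm (\sum_(0 <= j < m) power_sum V j b) <= m%:R * B.
      elim=> [|m IH]; first by rewrite big_nil rnorm0 mul0r.
      rewrite big_nat_recr//= (le_trans (rnormD _ _))// -natr1 mulrDl mul1r.
      by rewrite lerD.
    exact.
  suff -> : z - V z - b = - real_scale n.+1%:R^-1 (power_sum V n.+1 b).
    by rewrite rnormN rnormZ ger0_norm ?invr_ge0// mulrC ler_wpM2r ?invr_ge0.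
  have scN : of_real k (n.+1%:R^-1 : R) * n.+1%:R = 1.
    by rewrite -of_real_nat -of_realM mulVf// (of_real_nat R k 1).
  rewrite /z /real_scale VZ V_sum -[X in _ - X]scale1r -scN -scalerA.
  rewrite -!scalerBr -[RHS]scalerN; congr (_ *: _).
  have -> : \sum_(0 <= j < n.+1) V (power_sum V j b) =
      \sum_(0 <= j < n.+1) power_sum V j b + power_sum V n.+1 b - n.+1%:R *: b.
    under eq_bigr do rewrite V_psum.
    rewrite sumrB sumr_const_nat subn0 scaler_nat; congr (_ - _).
    rewrite -[RHS]big_nat_recr//= [RHS]big_nat_recl//=.
    by rewrite [X in _ = X + _]/power_sum big_nil add0r.
  by rewrite opprB addrA addrAC addrK opprD addrA subrr add0r.
- by move=> n x [].
- move=> n p np x [xB xe]; split => //; apply: le_trans xe _.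
  by rewrite ler_wpM2l// lef_pV2 ?posrE// ler_nat.
- move=> n x y [xB xe] [yB ye]; split.
    rewrite rnormZ ger0_norm ?invr_ge0//.
    have := rnormD x y; lra.
  have -> : real_scale 2^-1 (x + y) - V (real_scale 2^-1 (x + y)) - b =
     real_scale 2^-1 ((x - V x - b) + (y - V y - b)).
    rewrite /real_scale VZ VD.
    have bE : b = of_real k 2^-1 *: (b + b).
      have sc2 : of_real k (2^-1 : R) + of_real k 2^-1 = 1.
        by rewrite -of_realD -div1r -splitr (of_real_nat R k 1).
      by rewrite scalerDr -scalerDl sc2 scale1r.
    rewrite {1}bE -!scalerBr; congr (_ *: _).
    by rewrite !opprD (addrACA x y) [LHS]addrACA.
  rewrite rnormZ ger0_norm ?invr_ge0//.
  move: (B * _) xe ye (rnormD (x - V x - b) (y - V y - b)) => c.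
  by move: (rnorm _) (rnorm _) (rnorm _) => ? ? ?; lra.
move=> s [l [sC sl]]; exists l; apply/eqP; rewrite -subr_eq0; apply/eqP.
have lim1 : (fun n => s n - V (s n) - b) @ \oo --> l - V l - b.
  apply: cvgB; last exact: cvg_cst.
  by apply: cvgB => //; apply: continuous_cvg => //; exact: contV.
have lim2 : (fun n => s n - V (s n) - b) @ \oo --> (0 : H).
  apply/rnorm_cvgP.
  apply: (@squeeze_cvgr _ _ _ _ (cst 0) (fun n => B * n.+1%:R^-1)).
  - by apply: nearW => n; rewrite subr0 rnorm_ge0 (sC n).2.
  - exact: cvg_cst.
  - by rewrite -[X in _ --> X](mulr0 B); apply: cvgMl_tmp; exact: cvg_harmonic.
exact: (cvg_unique _ lim1 lim2).
Qed.
End RangeCriterion.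

Lemma cvg_dominated_dist (R : realType) (u : nat -> R) (l : R) (d : nat -> R) :
  (forall n, `|u n - l| <= d n) -> d @ \oo --> 0 -> u @ \oo --> l.
Proof.
move=> ud /cvgrPdist_lt d0; apply/cvgrPdist_lt => e e0.
apply: filterS (d0 e e0) => n; rewrite sub0r normrN; apply: le_lt_trans.
by rewrite distrC (le_trans (ud n))// ler_norm.
Qed.

(** * Everywhere limits of simple functions *)

Section FinitelyValued.
Context (R : realType).

(** The simple functions of the integral, with values in an arbitrary type:
    products with indicators and discretised times need values in bool and
    nat as well. *)
Definition finitely_valued (X : Type) (p : R -> X) : Prop :=
  finite_set (range p) /\ forall v, measurable (p @^-1` [set v]).

Lemma finitely_valued_preimage (X : Type) (p : R -> X) (Y : set X) :
  finitely_valued p -> measurable (p @^-1` Y).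
Proof.
move=> [fp mp].
have -> : p @^-1` Y = \bigcup_(v in range p `&` Y) p @^-1` [set v].
  apply/seteqP; split=> [x Yx|x [v [_ Yv] /= ->]//].
  by exists (p x) => //; split => //; exists x.
apply: fin_bigcup_measurable => // ; exact: finite_setIl.
Qed.

Lemma finitely_valued2 (X Y Z : Type) (h : X -> Y -> Z)
    (p : R -> X) (q : R -> Y) :
  finitely_valued p -> finitely_valued q ->
  finitely_valued (fun x => h (p x) (q x)).
Proof.
move=> fp fq; split; first exact: finite_image11 fp.1 fq.1.
move=> v.
have -> : (fun x => h (p x) (q x)) @^-1` [set v] =
    \bigcup_(y in range q) ((p @^-1` [set a | h a y = v]) `&` q @^-1` [set y]).
  apply/seteqP; split=> [x /= hv|x [y _] [/= + qy]]; last by rewrite qy.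
  by exists (q x); [exists x|split].
apply: fin_bigcup_measurable => [|y _]; first exact: fq.1.
apply: measurableI; [exact: finitely_valued_preimage|exact: fq.2].
Qed.

Lemma finitely_valued1 (X Z : Type) (h : X -> Z) (p : R -> X) :
  finitely_valued p -> finitely_valued (h \o p).
Proof. by move=> fp; exact: (finitely_valued2 (fun a _ => h a) fp fp). Qed.

Lemma finitely_valued_mem (D : set R) : measurable D ->
  finitely_valued (fun x => x \in D).
Proof.
move=> mD; split=> [|b]; first exact: finite_finset.
case: b.
  rewrite (_ : _ @^-1` _ = D)//; apply/seteqP.
  split => x /=; first exact: set_mem.
  by move=> Dx; rewrite mem_set.
rewrite (_ : _ @^-1` _ = ~` D); first exact: measurableC.
apply/seteqP; split => x /=.
  by move/negbT/negP => xD Dx; apply: xD; rewrite mem_set.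
by move=> Dx; rewrite memNset.
Qed.

Lemma finitely_valued_restrict (H : nmodType) (D : set R) (s : R -> H) :
  measurable D -> finitely_valued s ->
  finitely_valued (fun x => if x \in D then s x else 0).
Proof.
move=> mD fs.
exact: (finitely_valued2 (fun (b : bool) y => if b then y else 0)
  (finitely_valued_mem mD) fs).
Qed.

Lemma finitely_valued_measurable (p : R -> R) (D : set R) :
  finitely_valued p -> measurable_fun D p.
Proof.
by move=> fp mD Y mY; apply: measurableI => //; exact: finitely_valued_preimage.
Qed.

Lemma truncn_scaled_fiber (c : R) (m : nat) :
  measurable [set s : R | Num.truncn (c * s) = m].
Proof.
have mle n : measurable [set s : R | (Num.truncn (c * s) <= n)%N].
  rewrite (_ : [set _ | _] = ( *%R c) @^-1` `]-oo, n.+1%:R[%classic).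
    rewrite -[X in measurable X]setTI.
    by apply: (measurable_funM (measurable_cst c) (@measurable_id _ _ _)).
  by apply/seteqP; split => s /=; rewrite in_itv/= truncn_le_nat.
case: m => [|m].
  rewrite (_ : [set _ | _] = [set s : R | (Num.truncn (c * s) <= 0)%N])//.
  by apply/seteqP; split => s /=; rewrite leqn0 => /eqP.
rewrite (_ : [set _ | _] = [set s : R | (Num.truncn (c * s) <= m.+1)%N] `\`
   [set s : R | (Num.truncn (c * s) <= m)%N]); first exact: measurableD.
apply/seteqP; split => s /=; first by move=> ->; rewrite ltnn.
by move=> [? /negP]; rewrite -ltnNge => ?; apply/eqP; rewrite eqn_leq;
  apply/andP.
Qed.

(** The cap N only makes the range finite; on a bounded interval a large
    enough N leaves the truncation unchanged. *)
Lemma finitely_valued_truncn (c : R) (N : nat) :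
  finitely_valued (fun s => minn N (Num.truncn (c * s))).
Proof.
split.
  apply: (@sub_finite_set _ _ `I_N.+1); last exact: finite_II.
  by move=> _ [s _ <-] /=; rewrite ltnS geq_minl.
move=> m; case: (ltnP m N) => mN.
  rewrite (_ : _ @^-1` _ = [set s : R | Num.truncn (c * s) = m]).
    exact: truncn_scaled_fiber.
  apply/seteqP; split => s /=; last by move=> ->; rewrite (minn_idPr (ltnW mN)).
  by case: (leqP N (Num.truncn (c * s))) => // _ Nm; rewrite Nm ltnn in mN.
rewrite (_ : _ @^-1` _ = if m == N
    then ~` \bigcup_(j in `I_N) [set s : R | Num.truncn (c * s) = j] else set0).
  case: ifP => // _; apply: measurableC; apply: bigcup_measurable => j _.
  exact: truncn_scaled_fiber.
apply/seteqP; split => s /=.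
  move=> sm; have -> : m == N by rewrite eqn_leq mN -sm geq_minl.
  move=> [j /= jN sj]; move: sm; rewrite sj (minn_idPr (ltnW jN)) => jm.
  by move: jN; rewrite jm ltnNge mN.
case: eqP => // -> sN; apply/minn_idPl; rewrite leqNgt; apply/negP => lN.
by apply: sN; exists (Num.truncn (c * s)).
Qed.
End FinitelyValued.

Section StronglyBorel.
Context (R : realType) (k : scalar_kind) (H : normedModType (scalars R k)).

(** Limits are taken at every point: the Borel sigma-algebra is not complete,
    so an almost everywhere limit of simple functions may have a
    non-measurable norm. *)
Definition strongly_borel (g : R -> H) : Prop :=
  exists s : nat -> R -> H,
    (forall n, finitely_valued (s n)) /\ forall x, s ^~ x @ \oo --> g x.

Definition rlipschitz (h : H -> R) (C : R) : Prop :=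
  forall x y, `|h x - h y| <= C * rnorm (x - y).

Lemma rlipschitz_cvg h C (s : nat -> H) (l : H) : rlipschitz h C ->
  s @ \oo --> l -> (h \o s) @ \oo --> h l.
Proof.
move=> hC /rnorm_cvgP sl; apply: (cvg_dominated_dist (fun n => hC (s n) l)).
by rewrite -[X in _ --> X](mulr0 C); exact: cvgMl_tmp.
Qed.

Lemma strongly_borel_measurable g h C (D : set R) :
  strongly_borel g -> rlipschitz h C ->
  measurable_fun D (h \o g).
Proof.
move=> [s [fs sg]] hC; apply: (@measurable_fun_cvg _ _ _ _ (fun n => h \o s n)).
  by move=> n; apply: finitely_valued_measurable; exact: finitely_valued1.
by move=> x _; exact: (rlipschitz_cvg hC (sg x)).
Qed.

Lemma rlipschitz_rnorm : rlipschitz (@rnorm R k H) 1.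
Proof. by move=> x y; rewrite mul1r rnorm_dist. Qed.

Lemma strongly_borel_rnorm g D :
  strongly_borel g -> measurable_fun D (fun x => rnorm (g x)).
Proof.
by move=> bg; exact: (strongly_borel_measurable bg rlipschitz_rnorm).
Qed.

Lemma finitely_valued_strongly_borel s : finitely_valued s -> strongly_borel s.
Proof. by move=> fs; exists (fun=> s); split => // x; exact: cvg_cst. Qed.

Lemma strongly_borelB g h : strongly_borel g -> strongly_borel h ->
  strongly_borel (fun x => g x - h x).
Proof.
move=> [s [fs sg]] [s' [fs' sh]]; exists (fun n x => s n x - s' n x); split.
  by move=> n; exact: (finitely_valued2 (fun a b => a - b) (fs n) (fs' n)).
by move=> x; apply: cvgB; [exact: sg|exact: sh].
Qed.

Lemma strongly_borel_comp g (rho : R -> R) : measurable_fun setT rho ->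
  strongly_borel g -> strongly_borel (g \o rho).
Proof.
move=> mrho [s [fs sg]]; exists (fun n => s n \o rho); split; last first.
  by move=> x; exact: sg.
move=> n; split.
  by apply: sub_finite_set (fs n).1 => _ [x _ <-]; exists (rho x).
move=> v; rewrite comp_preimage -[X in measurable X]setTI.
by apply: mrho => //; exact: (fs n).2.
Qed.

(** Each approximant is set to 0 where its norm exceeds 2 |g|.  Where g x is
    nonzero this eventually changes nothing; where g x = 0 it leaves only the
    value 0.  The bound makes dominated convergence applicable. *)
Lemma strongly_borel_dominated g : strongly_borel g ->
  exists s : nat -> R -> H,
    [/\ forall n, finitely_valued (s n), forall x, s ^~ x @ \oo --> g x &
        forall n x, rnorm (s n x) <= 2 * rnorm (g x)].
Proof.
move=> bg; have [s [fs sg]] := bg.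
pose D n := [set x | rnorm (s n x) <= 2 * rnorm (g x)].
have mD n : measurable (D n).
  have : measurable_fun setT (fun x => rnorm (s n x) <= 2 * rnorm (g x)).
    apply: measurable_fun_ler.
      by apply: strongly_borel_rnorm; exact: finitely_valued_strongly_borel.
    by apply: measurable_funM => //; exact: strongly_borel_rnorm.
  move=> /(_ measurableT [set true] I); rewrite setTI.
  congr measurable; apply/seteqP; split => x //=.
exists (fun n x => if x \in D n then s n x else 0); split.
- by move=> n; exact: finitely_valued_restrict (mD n) (fs n).
- move=> x; have [g0|g0] := eqVneq (g x) 0.
    rewrite g0 (_ : (fun n => _) = cst 0); first exact: cvg_cst.
    apply/funext => n /=; case: ifP => // /set_mem.
    rewrite /D /= g0 rnorm0 mulr0 => s0; apply/rnorm_eq0/eqP.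
    by rewrite eq_le s0 rnorm_ge0.
  have gx0 : 0 < rnorm (g x).
    rewrite lt_neqAle rnorm_ge0 andbT eq_sym; apply: contra_neq g0.
    exact: rnorm_eq0.
  have := rlipschitz_cvg rlipschitz_rnorm (sg x).
  move=> /cvgrPdist_lt /(_ _ gx0) near_s.
  apply: cvg_trans (sg x); apply: near_eq_cvg; near=> n.
  rewrite mem_set//= /D /=.
  have : `|rnorm (g x) - rnorm (s n x)| < rnorm (g x) by near: n.
  by rewrite ltr_norml => /andP[? _]; lra.
- move=> n x; case: ifP => [/set_mem//|_]; rewrite rnorm0 mulr_ge0// rnorm_ge0.
Unshelve. all: by end_near. Qed.
End StronglyBorel.

(** * The Bochner integral through real functionals *)

Section LowerIntegral.
Context (R : realType).
Local Notation mu := (@lebesgue_measure R).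
Local Open Scope ereal_scope.
Import HBNNSimple.

(** The integral of a nonnegative function is a supremum over simple
    minorants, measurable or not, and setting a minorant to 0 on a null set
    does not change its integral.  This is what permits exchanging f with
    its Borel version inside integrals of |f - s n|, which need not be Borel
    functions. *)
Lemma ae_ge0_le_lower_integral (D : set R) (a b : R -> \bar R) : measurable D ->
  (forall x, D x -> 0 <= a x) -> (forall x, D x -> 0 <= b x) ->
  {ae mu, forall x, D x -> a x <= b x} ->
  \int[mu]_(x in D) a x <= \int[mu]_(x in D) b x.
Proof.
move=> mD a0 b0 [N [mN N0 abN]].
rewrite !ge0_integralE//; apply: ge_ereal_sup => _ [h /= ha <-].
have mNC := measurableC mN.
apply: (@le_trans _ _ (sintegral mu (proj_nnsfun h mNC))).
  rewrite -!integralT_nnsfun.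
  rewrite (@ge0_negligible_integral _ _ _ mu setT N)//=; last 2 first.
  - by apply/measurable_EFinP.
  - by move=> x _; rewrite lee_fin.
  rewrite setTD integral_mkcond; apply: ge0_le_integral => //=.
  - by move=> x _; apply: erestrict_ge0 => y _; rewrite lee_fin.
  - apply: (measurable_restrictT (fun x => (h x)%:E) mNC).1.
    by apply/measurable_EFinP; exact: measurable_funTS.
  - by apply/measurable_EFinP; exact: (measurable_funP (proj_nnsfun h mNC)).
  - move=> x _; rewrite patchE mindicE; case: ifPn => xN; rewrite ?mulr1//.
    by rewrite lee_fin mulr0.
apply: ereal_sup_ubound; exists (proj_nnsfun h mNC) => //= x.
rewrite mindicE patchE; have := ha x; rewrite patchE.
case: ifPn => xD hx.
  case: (boolP (x \in ~` N)) => [/set_mem xN|_]; last first.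
    by rewrite mulr0 b0//; exact: set_mem.
  rewrite mulr1; apply: le_trans hx _; apply: contrapT => nab; apply: xN.
  by apply: abN => /= /(_ (set_mem xD)).
have -> : h x = 0%R by apply/le_anti; rewrite -(lee_fin (h x)) hx /= fun_ge0.
by rewrite mul0r.
Qed.
End LowerIntegral.

Section Functionals.
Context (R : realType) (k : scalar_kind) (H : normedModType (scalars R k)).
Local Notation mu := (@lebesgue_measure R).

(** Bounded real-linear functionals, kept real over complex scalars so that
    their integrals are real Lebesgue integrals. *)
Record real_functional (phi : H -> R) (C : R) : Prop := RealFunctional {
  rf_add : forall x y, phi (x + y) = phi x + phi y;
  rf_scale : forall r x, phi (real_scale r x) = r * phi x;
  rf_bound : forall x, `|phi x| <= C * rnorm x }.

Section Basic.
Context (phi : H -> R) (C : R) (fphi : real_functional phi C).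

Lemma rfB x y : phi (x - y) = phi x - phi y.
Proof. by rewrite (rf_add fphi) -real_scaleN1 (rf_scale fphi) mulN1r. Qed.

Lemma rf0 : phi 0 = 0.
Proof. by have := rfB 0 0; rewrite !subrr. Qed.

Lemma rf_lipschitz : rlipschitz phi C.
Proof. by move=> x y; rewrite -rfB; exact: rf_bound. Qed.

Lemma rf_sum (I : Type) (s : seq I) (F : I -> H) :
  phi (\sum_(i <- s) F i) = \sum_(i <- s) phi (F i).
Proof.
by elim: s => [|i s IH]; rewrite ?big_nil ?rf0// !big_cons (rf_add fphi) IH.
Qed.

Lemma rf_simple_integral (D : set R) (s : R -> H) :
  measurable D -> (mu D < +oo)%E -> finitely_valued s ->
  (\int[mu]_(x in D) (phi (s x))%:E = (phi (simple_integral D s))%:E)%E.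
Proof.
move=> mD Dfin fs; rewrite /simple_integral fsbig_finite//=; last exact: fs.1.
rewrite rf_sum.
have sE x : phi (s x) =
    \sum_(v <- fset_set (range s)) phi v * \1_(s @^-1` [set v]) x.
  rewrite (big_fsetD1 (s x)) /=; last first.
    by rewrite in_fset_set; [apply/mem_set; exists x|exact: fs.1].
  rewrite indicE mem_set//= mulr1 big1_fset ?addr0// => v.
  rewrite !inE => /andP[vs _] _; rewrite indicE memNset ?mulr0//= => sv.
  by rewrite sv eqxx in vs.
under eq_integral => x _ do rewrite sE -sumEFin.
have intI v : mu.-integrable D (fun x => (\1_(s @^-1` [set v]) x : R)%:E).
  apply/integrableP; split.
    by apply/measurable_EFinP; apply: measurable_indic; exact: fs.2.
  under eq_integral => x _ do rewrite gee0_abs ?lee_fin ?indicE//.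
  rewrite -/(\int[mu]_(x in D) ((\1_(s @^-1` [set v]) x)%:E))%E.
  rewrite integral_indic//; last exact: fs.2.
  by apply: le_lt_trans Dfin; apply: measureIr => //; exact: fs.2.
rewrite integral_sum//; last first.
  by move=> v; under eq_fun do rewrite EFinM; exact: integrableZl.
rewrite -sumEFin; apply: eq_bigr => v _.
under eq_integral do rewrite EFinM.
rewrite integralZl// integral_indic//; last exact: fs.2.
rewrite (rf_scale fphi) mulrC EFinM fineK; first by rewrite setIC muleC.
rewrite ge0_fin_numE//; apply: le_lt_trans Dfin.
by apply: measureIl => //; exact: fs.2.
Qed.
End Basic.
End Functionals.

Section BochnerScalar.
Context (R : realType) (k : scalar_kind) (H : normedModType (scalars R k)).
Local Notation mu := (@lebesgue_measure R).
Implicit Type D : set (measurableTypeR R).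

Definition rnorm_integrable (D : set (measurableTypeR R)) (g : R -> H) : Prop :=
  strongly_borel g /\ mu.-integrable D (fun x => (rnorm (g x))%:E).

Lemma rnorm_integrable_le D (g h : R -> H) (c : R) : measurable D ->
  rnorm_integrable D g -> strongly_borel h ->
  (forall x, D x -> rnorm (h x) <= c * rnorm (g x)) -> rnorm_integrable D h.
Proof.
move=> mD [bg ig] bh hg; split => //.
apply: (le_integrable mD _ _ (integrableZl mD c ig)) => //.
  by apply/measurable_EFinP; exact: strongly_borel_rnorm.
move=> x Dx /=; rewrite lee_fin ger0_norm ?rnorm_ge0//.
by rewrite (le_trans (hg x Dx))// ler_norm.
Qed.

Lemma finitely_valued_rnorm_integrable D (s : R -> H) : measurable D ->
  (mu D < +oo)%E -> finitely_valued s -> rnorm_integrable D s.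
Proof.
move=> mD Dfin fs; have bs := finitely_valued_strongly_borel fs; split => //.
apply: measurable_bounded_integrable => //; first exact: strongly_borel_rnorm.
exists (\sum_(v <- fset_set (range s)) rnorm v); split; first exact: num_real.
move=> M ltM x Dx /=; apply: le_trans (ltW ltM).
rewrite ger0_norm ?rnorm_ge0// (big_fsetD1 (s x)) /=; last first.
  by rewrite in_fset_set; [apply/mem_set; exists x|exact: fs.1].
by rewrite lerDl sumr_ge0// => v _; exact: rnorm_ge0.
Qed.

Lemma rnorm_integrableB D (g h : R -> H) : measurable D ->
  rnorm_integrable D g -> rnorm_integrable D h ->
  rnorm_integrable D (fun x => g x - h x).
Proof.
move=> mD [bg ig] [bh ih]; have bgh := strongly_borelB bg bh; split => //.
apply: (le_integrable mD _ _ (integrableD mD ig ih)) => //.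
  by apply/measurable_EFinP; exact: strongly_borel_rnorm.
move=> x Dx /=; rewrite lee_fin ger0_norm ?rnorm_ge0// ger0_norm ?rnormB//.
by rewrite addr_ge0 ?rnorm_ge0.
Qed.

Lemma rf_integrable D (g : R -> H) phi C : measurable D ->
  real_functional phi C -> rnorm_integrable D g ->
  mu.-integrable D (EFin \o (phi \o g)).
Proof.
move=> mD fphi [bg ig].
apply: (le_integrable mD _ _ (integrableZl mD C ig)) => //.
  apply/measurable_EFinP.
  exact: strongly_borel_measurable bg (rf_lipschitz fphi).
by move=> x Dx /=; rewrite lee_fin (le_trans (rf_bound fphi _))// ler_norm.
Qed.

Lemma rf_Rintegral_le D (g : R -> H) phi C : measurable D ->
  real_functional phi C -> rnorm_integrable D g ->
  `|\int[mu]_(x in D) phi (g x)| <= C * \int[mu]_(x in D) rnorm (g x).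
Proof.
move=> mD fphi ig; have iphi := rf_integrable mD fphi ig.
apply: (le_trans (le_normr_Rintegral mD iphi)).
rewrite -RintegralZl//; last exact: ig.2.
apply: le_Rintegral => //.
- exact: integrable_norm iphi.
- by have := integrableZl mD C ig.2.
- by move=> x _; exact: (rf_bound fphi).
Qed.

(** Used twice: with the functional x |-> Re <x, y> it makes integrals of
    approximants a Cauchy sequence, and with a general one it identifies the
    limit. *)
Lemma rf_simple_integral_dist D (g s : R -> H) phi C : measurable D ->
  (mu D < +oo)%E -> real_functional phi C -> rnorm_integrable D g ->
  finitely_valued s ->
  `|phi (simple_integral D s) - \int[mu]_(x in D) phi (g x)| <=
    C * \int[mu]_(x in D) rnorm (g x - s x).
Proof.
move=> mD Dfin fphi ig fs.
have is_ := finitely_valued_rnorm_integrable mD Dfin fs.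
have -> : phi (simple_integral D s) = \int[mu]_(x in D) phi (s x).
  by rewrite /Rintegral (rf_simple_integral fphi).
rewrite distrC -RintegralB//.
- under eq_Rintegral do rewrite -(rfB fphi).
  by apply: (rf_Rintegral_le mD fphi); exact: rnorm_integrableB.
- exact: rf_integrable fphi ig.
- exact: rf_integrable fphi is_.
Qed.

Lemma rnorm_integrable_simple_approx D (g : R -> H) : measurable D ->
  rnorm_integrable D g ->
  exists s : nat -> R -> H,
    [/\ forall n, finitely_valued (s n), forall x, s ^~ x @ \oo --> g x &
       (\int[mu]_(x in D) (rnorm (g x - s n x))%:E)%E @[n --> \oo] --> 0%E].
Proof.
move=> mD [bg ig]; have [s [fs sg sle]] := strongly_borel_dominated bg.
exists s; split => //.
have [] := @dominated_convergence _ _ _ mu D mD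
  (fun n x => (rnorm (g x - s n x))%:E) (cst 0%E)
  (fun x => 3%:E * (rnorm (g x))%:E)%E.
- move=> n; apply/measurable_EFinP; apply: strongly_borel_rnorm.
  by apply: strongly_borelB => //; exact: finitely_valued_strongly_borel.
- exact: measurable_cst.
- apply: aeW => x _; apply: cvg_EFin; first exact: nearW.
  have /rnorm_cvgP := sg x.
  by under eq_fun do rewrite rnormBC.
- exact: integrableZl.
- apply: aeW => x n _; rewrite gee0_abs ?lee_fin ?rnorm_ge0//.
  by rewrite (le_trans (rnormB _ _))//; have := sle n x; lra.
by move=> _ _; rewrite integral0.
Qed.
End BochnerScalar.

Section BochnerHilbert.
Context (R : realType) (k : scalar_kind).
Context (H : completeNormedModType (scalars R k)).
Context (dot : {dot H for @conj_scalar R k}).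
Context (dot_norm : forall x : H, dot x x = `|x| ^+ 2).
Local Notation mu := (@lebesgue_measure R).
Implicit Type D : set (measurableTypeR R).
Local Notation rdot := (rdot dot).

Lemma rdot_functional (y : H) : real_functional (rdot^~ y) (rnorm y).
Proof.
split=> [x z|r x|x]; [exact: rdotDl|exact: rdotZl|].
by rewrite mulrC; exact: rdot_le.
Qed.

(** Testing against the vector itself turns bounds on functionals of an
    integral into a bound on its norm. *)
Lemma rnorm_le_rdot (x : H) (c : R) : 0 <= c ->
  `|rdot x x| <= c * rnorm x -> rnorm x <= c.
Proof.
move=> c0; rewrite rdotxx// ger0_norm ?sqr_ge0// expr2.
have [->//|x0] := eqVneq (rnorm x) 0.
by rewrite ler_pM2r// lt_neqAle eq_sym x0 rnorm_ge0.
Qed.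

Lemma rdot_ext (x y : H) : (forall z, rdot x z = rdot y z) -> x = y.
Proof.
move=> xy; apply/eqP; rewrite -subr_eq0; apply/eqP/rnorm_eq0/eqP.
rewrite eq_le rnorm_ge0 andbT; apply: rnorm_le_rdot => //.
by rewrite (rfB (rdot_functional _)) xy subrr normr0 mul0r.
Qed.

(** For any approximating sequence the functional of the simple integrals
    converges both to phi v and to the real integral, so every Bochner
    integral v has these values.  One exists since dominated approximants
    have simple integrals forming a Cauchy sequence; hence [xget] does not
    fall back to its default. *)
Lemma rf_bochner_integral (D : set (measurableTypeR R)) (f g : R -> H) phi C :
  measurable D -> (mu D < +oo)%E -> rnorm_integrable D g ->
  {ae mu, forall x, D x -> f x = g x} -> real_functional phi C ->
  phi (bochner_integral D f) = \int[mu]_(x in D) phi (g x).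
Proof.
move=> mD Dfin ig fg fphi.
have int_fg s : (\int[mu]_(x in D) (rnorm (f x - s x))%:E =
    \int[mu]_(x in D) (rnorm (g x - s x))%:E)%E.
  apply/eqP; rewrite eq_le; apply/andP; split.
    apply: ae_ge0_le_lower_integral => //; try by
      move=> *; rewrite lee_fin rnorm_ge0.
    by apply: filterS fg => x /[apply] ->.
  apply: ae_ge0_le_lower_integral => //; try by
    move=> *; rewrite lee_fin rnorm_ge0.
  by apply: filterS fg => x /[apply] ->.
have fine_cvg s : (forall n, finitely_valued (s n)) ->
    (\int[mu]_(x in D) (rnorm (g x - s n x))%:E)%E @[n --> \oo] --> 0%E ->
    (fun n => \int[mu]_(x in D) rnorm (g x - s n x)) @ \oo --> 0.
  by move=> fs; move/fine_cvgP => [_].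
have value v : is_bochner_integral D f v -> phi v = \int[mu]_(x in D) phi (g x).
  move=> [s [[fs _] s0 sv]].
  move: s0; under eq_fun do rewrite int_fg; move=> s0.
  have lim1 := rlipschitz_cvg (rf_lipschitz fphi) sv.
  have lim2 : (phi \o (fun n => simple_integral D (s n))) @ \oo -->
      \int[mu]_(x in D) phi (g x).
    apply: (cvg_dominated_dist (fun n =>
      rf_simple_integral_dist mD Dfin fphi ig (fs n))).
    by rewrite -[X in _ --> X](mulr0 C); apply: cvgMl_tmp; exact: fine_cvg.
  exact: (cvg_unique _ lim1 lim2).
apply: value; rewrite /bochner_integral; apply: xgetPex.
have [s [fs sg s0]] := rnorm_integrable_simple_approx mD ig.
have [|v sv] := @rnorm_cauchy_cvg _ _ _ (fun n => simple_integral D (s n))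
   (fun n => \int[mu]_(x in D) rnorm (g x - s n x)) (fine_cvg _ fs s0).
  move=> n p _; apply: rnorm_le_rdot.
    by rewrite addr_ge0// Rintegral_ge0// => x _; exact: rnorm_ge0.
  set y := _ - _; have fy := rdot_functional y.
  have dn := rf_simple_integral_dist mD Dfin fy ig (fs n).
  have dp := rf_simple_integral_dist mD Dfin fy ig (fs p).
  have -> : rdot y y = rdot (simple_integral D (s n)) y -
      rdot (simple_integral D (s p)) y := rfB fy _ _.
  rewrite mulrC mulrDr.
  apply: le_trans (ler_distD (\int[mu]_(x in D) rdot (g x) y) _ _) _.
  by apply: lerD => //; rewrite distrC.
exists v, s; split => //; last first.
  by under eq_fun do rewrite int_fg.
split => //.
by apply: filterS fg => x /[apply] ->; exact: sg.
Qed.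
End BochnerHilbert.

(** * Translation invariance and periodic functions *)

Section Translation.
Context (R : realType).
Local Notation mu := (@lebesgue_measure R).
Implicit Types (D : set (measurableTypeR R)) (c : R).

Definition shift_by c (x : measurableTypeR R) : measurableTypeR R := x + c.

Lemma measurable_shift_by c : measurable_fun setT (shift_by c).
Proof. exact: (@measurable_funD _ _ _ _ (@id R) (cst c)). Qed.

(** Lebesgue measure and its translate agree on half-open intervals. *)
Lemma lebesgue_measure_shift c D : measurable D ->
  mu (shift_by c @^-1` D) = mu D.
Proof.
move=> mD; have mc := measurable_shift_by c.
apply/esym.
apply: (lebesgue_measure_unique (mu := pushforward mu (shift_by c))) => //.
move=> _ [[a b] _ <-] /=; rewrite /pushforward.
have -> : shift_by c @^-1` `]a, b]%classic = `]a - c, b - c]%classic.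
  by apply/seteqP; split => x /=; rewrite !in_itv/= /shift_by ltrBlDr lerBrDr.
rewrite !lebesgue_measure_itv /= !lte_fin ltrD2r; case: ifP => // _.
by rewrite -!EFinB; congr (_%:E); lra.
Qed.

Lemma ge0_integral_shift c D (f : R -> \bar R) : measurable D ->
  measurable_fun D f -> (forall x, D x -> 0 <= f x)%E ->
  (\int[mu]_(x in shift_by c @^-1` D) f (x + c)%R = \int[mu]_(x in D) f x)%E.
Proof.
move=> mD mf f0; have mc := measurable_shift_by c.
rewrite -[LHS](@ge0_integral_pushforward _ _ _ _ _ _ mc mu D f)//; last first.
  by move=> x xD; apply: f0; exact: set_mem.
by apply: eq_measure_integral => A mA _; exact: lebesgue_measure_shift.
Qed.

Lemma integral_shift c D (f : R -> \bar R) : measurable D ->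
  measurable_fun setT f ->
  mu.-integrable (shift_by c @^-1` D) (f \o shift_by c) ->
  (\int[mu]_(x in shift_by c @^-1` D) f (x + c)%R = \int[mu]_(x in D) f x)%E.
Proof.
move=> mD mf int_f; have mc := measurable_shift_by c.
rewrite -[LHS](@integral_pushforward _ _ _ _ _ _ mc mu D f)//.
by apply: eq_measure_integral => A mA _; exact: lebesgue_measure_shift.
Qed.
End Translation.

Section PeriodicVersion.
Context (R : realType) (k : scalar_kind) (H : normedModType (scalars R k)).
Local Notation mu := (@lebesgue_measure R).
Implicit Type D : set (measurableTypeR R).

(** Set f to 0 on a null Borel set that contains the points where the
    approximants fail to converge. *)
Lemma L1_borel_version D (f : R -> H) : measurable D -> L1 D f ->
  exists2 g : R -> H,
    rnorm_integrable D g & {ae mu, forall x, D x -> f x = g x}.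
Proof.
move=> mD [[s [fs [N [mN N0 sN]]]] f_fin].
have mDN : measurable (D `\` N) by exact: measurableD.
pose g x := if x \in D `\` N then f x else 0.
have bg : strongly_borel g.
  exists (fun n x => if x \in D `\` N then s n x else 0); split.
    by move=> n; exact: finitely_valued_restrict mDN (fs n).
  move=> x; rewrite /g; case: ifPn => [/set_mem[Dx xN]|_]; last exact: cvg_cst.
  by apply: contrapT => nsf; apply: xN; apply: sN => /= /(_ Dx).
exists g; last first.
  exists N; split => // x /= nfg; apply: contrapT => xN; apply: nfg => Dx.
  by rewrite /g mem_set.
split => //; apply/integrableP; split.
  by apply/measurable_EFinP; exact: strongly_borel_rnorm.
apply: le_lt_trans f_fin; apply: ae_ge0_le_lower_integral => //.
  by move=> x _; rewrite lee_fin rnorm_ge0.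
apply: aeW => x _; rewrite gee0_abs ?lee_fin ?rnorm_ge0// /g.
by case: ifP => // _; rewrite rnorm0 rnorm_ge0.
Qed.

Context (T : R) (T0 : 0 < T).

Definition period_index (x : R) : nat := Num.truncn (T^-1 * x).
(** Remainder modulo T in [0, T[ for nonnegative arguments; a negative
    number is its own remainder, as truncation sends it to 0. *)
Definition period_rem (x : R) : R := x - T * (period_index x)%:R.

Lemma period_remP x : 0 <= x -> 0 <= period_rem x < T.
Proof.
move=> x0; have /truncn_itv : 0 <= T^-1 * x by rewrite mulr_ge0// invr_ge0 ltW.
rewrite /period_rem /period_index; set n := Num.truncn _.
rewrite ler_pdivlMl// ltr_pdivrMl// -natr1 mulrDr mulr1 => /andP[? ?].
by apply/andP; split; lra.
Qed.

Lemma period_index_small x : 0 <= x < T -> period_index x = 0%N.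
Proof.
move=> /andP[x0 xT]; apply: truncn_def; rewrite mulr_ge0 ?invr_ge0 ?(ltW T0)//=.
by rewrite ltr_pdivrMl// mulr1.
Qed.

Lemma period_remD x : 0 <= x -> period_rem (x + T) = period_rem x.
Proof.
move=> x0; have /truncn_itv : 0 <= T^-1 * x by rewrite mulr_ge0// invr_ge0 ltW.
rewrite /period_rem /period_index => /andP[xl xu].
rewrite (@truncn_def _ _ (Num.truncn (T^-1 * x)).+1).
  by rewrite -natr1 mulrDr mulr1; lra.
by rewrite mulrDr mulVf ?gt_eqF// -natr1 lerD2r xl /= -natr1 ltrD2r.
Qed.

Lemma measurable_period_rem :
  measurable_fun setT (period_rem : measurableTypeR R -> measurableTypeR R).
Proof.
move=> _ Y mY; rewrite setTI.
have -> : period_rem @^-1` Y = \bigcup_m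
   ([set x | Num.truncn (T^-1 * x) = m] `&` shift_by (- (T * m%:R)) @^-1` Y).
  apply/seteqP; split => [x Yx|x [m _ [/= mx]]].
    by exists (period_index x).
  by rewrite /shift_by /period_rem /period_index mx.
apply: bigcupT_measurable => m; apply: measurableI.
  exact: truncn_scaled_fiber.
by rewrite -[X in measurable X]setTI; apply: measurable_shift_by.
Qed.

Lemma periodic_natmul (X : Type) (f : R -> X) n t :
  (forall t, f (t + T) = f t) ->
  f (t + T * n%:R) = f t.
Proof.
move=> fT; elim: n => [|n IH]; first by rewrite mulr0 addr0.
by rewrite -natr1 mulrDr mulr1 addrA fT.
Qed.

(** Compose a version on [0, T] with the remainder modulo T.  The points of
    disagreement lie in countably many translates of one null set, and the
    integral over [0, n T[ is finite by induction on n, translating the last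
    period back to [0, T[. *)
Lemma periodic_borel_version (f : R -> H) : L1_periodic T f ->
  exists g : R -> H,
    [/\ forall t, rnorm_integrable `[0, t] g,
        forall t, 0 <= t -> g (t + T) = g t &
        {ae mu, forall x, 0 <= x -> f x = g x}].
Proof.
move=> [f_L1 fT].
have mI : measurable (`[0, T]%classic : set (measurableTypeR R)).
  exact: measurable_itv.
have [f1 [bf1 if1] [N [mN N0 ff1N]]] := L1_borel_version mI f_L1.
(* At T the remainder is 0, hence the half-open intervals below. *)
pose g := f1 \o period_rem.
have bg : strongly_borel g := strongly_borel_comp measurable_period_rem bf1.
have gT t : 0 <= t -> g (t + T) = g t.
  by move=> t0; rewrite /g /= period_remD.
have gnT n t : 0 <= t -> g (t + T * n%:R) = g t.
  move=> t0; elim: n => [|n IH]; first by rewrite mulr0 addr0.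
  by rewrite -natr1 mulrDr mulr1 addrA gT// addr_ge0// mulr_ge0// ltW.
exists g; split => //; last first.
  apply: (@negligibleS _ _ _ _ (\bigcup_m (shift_by (- (T * m%:R)) @^-1` N))).
    move=> x /= /not_implyP[x0 fgx]; exists (period_index x) => //.
    apply: ff1N => /= ff1; apply: fgx; rewrite /g /=.
    rewrite -ff1; last first.
      by rewrite /= in_itv/=; have /andP[-> /ltW ->] := period_remP x0.
    by rewrite -(periodic_natmul (period_index x) (x - _) fT) subrK.
  apply: negligible_bigcup => m; apply/negligibleP.
    by rewrite -[X in measurable X]setTI; apply: measurable_shift_by.
  exact: (etrans (lebesgue_measure_shift _ mN) N0).
move=> t; split => //.
have mg D : measurable_fun D (fun x => (rnorm (g x))%:E).
  by apply/measurable_EFinP; exact: strongly_borel_rnorm.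
pose J (a b : R) : set (measurableTypeR R) := `[a, b[%classic.
have mJ a b : measurable (J a b) by exact: measurable_itv.
have fin1 : (\int[mu]_(x in J 0%R T) (rnorm (g x))%:E < +oo)%E.
  rewrite (@eq_integral _ _ _ _ _
    (fun x : measurableTypeR R => (rnorm (f1 x))%:E)); last first.
    move=> x /set_mem; rewrite /J /= in_itv /= => xT.
    by rewrite /g /= /period_rem period_index_small// mulr0 subr0.
  move/integrableP : if1 => [_]; apply: le_lt_trans.
  under [leRHS]eq_integral do rewrite gee0_abs ?lee_fin ?rnorm_ge0//.
  apply: ge0_subset_integral => //.
  - by apply/measurable_EFinP; exact: strongly_borel_rnorm.
  - by move=> x _; rewrite lee_fin rnorm_ge0.
  - by move=> x; rewrite /J /= !in_itv/= => /andP[-> /ltW ->].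
have finn n : (\int[mu]_(x in J 0%R (T * n%:R)%R) (rnorm (g x))%:E < +oo)%E.
  elim: n => [|n IH].
    by rewrite mulr0 /J set_itvE integral_set0.
  rewrite (_ : J 0 _ =
    J 0 (T * n%:R) `|` J (T * n%:R) (T * n.+1%:R)); last first.
    rewrite /J -itv_bndbnd_setU// bnd_simp.
      by rewrite mulr_ge0// ltW.
    by rewrite ler_pM2l// ler_nat.
  rewrite ge0_integral_setU//=; last 2 first.
  - by move=> x _; rewrite lee_fin rnorm_ge0.
  - apply/disj_setPLR => x; rewrite /J /= !in_itv/= => /andP[_ xn] /andP[+ _].
    by rewrite leNgt xn.
  apply: lte_add_pinfty => //.
  rewrite -(@ge0_integral_shift _ (T * n%:R))//; last first.
    by move=> x _; rewrite lee_fin rnorm_ge0.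
  rewrite (_ : _ @^-1` _ = J 0 T); last first.
    apply/seteqP.
    split => x; rewrite /J /shift_by /= !in_itv/= -natr1 mulrDr mulr1.
      by move=> /andP[? ?]; apply/andP; split; lra.
    by move=> /andP[? ?]; apply/andP; split; lra.
  rewrite (@eq_integral _ _ _ _ _
    (fun x : measurableTypeR R => (rnorm (g x))%:E))//.
  by move=> x /set_mem; rewrite /J /= in_itv /= => /andP[x0 _]; rewrite gnT.
apply/integrableP; split => //.
under eq_integral do rewrite gee0_abs ?lee_fin ?rnorm_ge0//.
apply: le_lt_trans (finn (period_index t).+1).
apply: ge0_subset_integral => //.
- by move=> x _; rewrite lee_fin rnorm_ge0.
- move=> x; rewrite /J /= !in_itv/= => /andP[x0 xt]; rewrite x0 /=.
  have := period_remP (le_trans x0 xt); rewrite /period_rem -natr1 mulrDr mulr1.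
  by move=> /andP[? ?]; lra.
Qed.
End PeriodicVersion.

(** * Orbits of the semigroup and the Duhamel integrand *)

Section Orbits.
Context (R : realType) (k : scalar_kind) (H : normedModType (scalars R k)).
Context (S : R -> H -> H) (C0S : C0_semigroup S).
Context (M : R) (M0 : 0 <= M).
Context (SM : forall t, 0 <= t -> forall x, rnorm (S t x) <= M * rnorm x).
Local Notation mu := (@lebesgue_measure R).

(** The operators at negative times are arbitrary; clipping the time at 0
    gives orbits that are continuous on all of R. *)
Definition clipped_orbit (t : R) (x : H) : H := S (Num.max 0 t) x.
Local Notation Sp := clipped_orbit.

Lemma max0_ge0 (t : R) : 0 <= Num.max 0 t.
Proof. by rewrite le_max lexx. Qed.

Lemma clipped_orbitE t x : 0 <= t -> Sp t x = S t x.
Proof. by move=> t0; rewrite /Sp max_r. Qed.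

Lemma clipped_orbit_linear t : linear (Sp t).
Proof. exact: C0_linear C0S _ (max0_ge0 t). Qed.

Lemma clipped_orbitB t x y : Sp t (x - y) = Sp t x - Sp t y.
Proof. exact: plain_linearB (clipped_orbit_linear t) x y. Qed.

Lemma clipped_orbit_bound t x : rnorm (Sp t x) <= M * rnorm x.
Proof. exact/SM/max0_ge0. Qed.

Lemma orbit_at0 (x : H) (e : R) : 0 < e ->
  exists2 d, 0 < d & forall h, 0 <= h < d -> rnorm (S h x - x) < e.
Proof.
move=> e0.
have := @C0_strong _ _ _ _ C0S x.
move=> /rnorm_cvgP /cvgrPdist_lt /(_ e e0) [d /= d0 dP].
exists d => // h /andP[h0 hd]; have [->|hn0] := eqVneq h 0.
  by rewrite (C0_id C0S) subrr rnorm0.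
have /= := dP h; rewrite !sub0r !normrN (ger0_norm h0) ger0_norm ?rnorm_ge0//.
by apply => //; rewrite lt_neqAle eq_sym hn0.
Qed.

(** For times b <= a, S a x - S b x = S b (S (a - b) x - x), so that right
    continuity at 0 and the uniform bound give continuity on both sides at
    every time. *)
Lemma clipped_orbit_dist a b x :
  rnorm (Sp a x - Sp b x) <= M * rnorm (Sp `|Num.max 0 a - Num.max 0 b| x - x).
Proof.
wlog ba : a b / b <= a.
  move=> W; case: (leP b a) => [|/ltW ab]; first exact: W.
  by rewrite rnormBC (distrC (Num.max 0 a)); exact: W.
have mba : Num.max 0 b <= Num.max 0 a by rewrite ge_max !le_max lexx ba orbT.
rewrite ger0_norm ?subr_ge0// (@clipped_orbitE (_ - _)) ?subr_ge0//.
have -> : Sp a x = S (Num.max 0 b) (S (Num.max 0 a - Num.max 0 b) x).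
  by rewrite -(C0_add C0S) ?max0_ge0 ?subr_ge0// addrC subrK.
rewrite /Sp -(plain_linearB (C0_linear C0S (max0_ge0 b))).
exact/SM/max0_ge0.
Qed.

Lemma clipped_orbit_cvg (u : nat -> R) (v : nat -> H) (t : R) (x : H) :
  u @ \oo --> t -> v @ \oo --> x ->
  (fun n => Sp (u n) (v n)) @ \oo --> Sp t x.
Proof.
move=> ut /rnorm_cvgP /cvgrPdist_lt vx; apply/rnorm_cvgP/cvgrPdist_lt => e e0.
(* With M + 1 instead of M, M times this bound is strictly below e / 2. *)
have e'0 : 0 < e / (2 * (M + 1)).
  by rewrite divr_gt0// mulr_gt0// ltr_wpDl.
have [d d0 dP] := orbit_at0 x e'0.
move/cvgrPdist_lt : ut => /(_ d d0) ut.
have {}vx := vx _ e'0.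
near=> n.
rewrite sub0r normrN ger0_norm ?rnorm_ge0//.
apply: le_lt_trans (rnorm_distD (Sp (u n) x) _ _) _.
rewrite -clipped_orbitB.
have b1 := clipped_orbit_bound (u n) (v n - x).
have b2 := clipped_orbit_dist (u n) t x.
have c1 : rnorm (v n - x) < e / (2 * (M + 1)).
  have : `|0 - rnorm (v n - x)| < e / (2 * (M + 1)) by near: n.
  by rewrite sub0r normrN ger0_norm ?rnorm_ge0.
have c2 : rnorm (Sp `|Num.max 0 (u n) - Num.max 0 t| x - x) < e / (2 * (M + 1)).
  rewrite clipped_orbitE//; apply: dP; rewrite normr_ge0 /=.
  have : `|t - u n| < d by near: n.
  rewrite distrC; apply: le_lt_trans.
  case: (leP 0 (u n)) => hu; case: (leP 0 t) => ht //;
    rewrite ?subrr ?normr0 ?normr_ge0//.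
    rewrite subr0 !ger0_norm//; lra.
  rewrite sub0r normrN ger0_norm// ltr0_norm; lra.
have Me : M * (e / (2 * (M + 1))) < e / 2.
  rewrite mulrA ltr_pdivrMr ?mulr_gt0 ?ltr_wpDl//.
  rewrite (_ : e / 2 * _ = e * (M + 1)); last by field.
  by rewrite mulrC ltr_pM2l// ltrDl.
rewrite (splitr e); apply: ltrD; apply: le_lt_trans _ Me.
  exact: le_trans b1 (ler_wpM2l M0 (ltW c1)).
exact: le_trans b2 (ler_wpM2l M0 (ltW c2)).
Unshelve. all: by end_near. Qed.

(** Extended by 0 outside [0, t], so that the integrals for different t can
    be compared over one interval. *)
Definition duhamel (g : R -> H) (t s : R) : H :=
  if s \in `[0, t]%classic then Sp (t - s) (g s) else 0.

Lemma duhamel_bound g t s : rnorm (duhamel g t s) <= M * rnorm (g s).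
Proof.
rewrite /duhamel; case: ifP => _; first exact: clipped_orbit_bound.
by rewrite rnorm0 mulr_ge0// rnorm_ge0.
Qed.

(** Approximants: evaluate the operator at t minus s rounded down to a
    multiple of 1 / (n + 1), on the n-th simple approximant of g.  They take
    finitely many values, and converge because (time, vector) |-> S time
    vector is jointly continuous. *)
Lemma strongly_borel_duhamel g t :
  strongly_borel g -> strongly_borel (duhamel g t).
Proof.
move=> [s [fs sg]].
have mI : measurable (`[0, t]%classic : set R) by exact: measurable_itv.
pose p n (x : R) := minn (Num.truncn (n.+1%:R * t)) (Num.truncn (n.+1%:R * x)).
pose F n (x : R) : H :=
  if x \in `[0, t]%classic then Sp (t - (p n x)%:R / n.+1%:R) (s n x) else 0.
exists F; split.
  move=> n; pose h (m : nat) (v : H) := Sp (t - m%:R / n.+1%:R) v.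
  apply: (finitely_valued_restrict mI).
  exact: (finitely_valued2 h (finitely_valued_truncn _ _) (fs n)).
move=> x; rewrite /F /duhamel; case: ifP => [/set_mem|_]; last exact: cvg_cst.
rewrite /= in_itv/= => /andP[x0 xt].
apply: clipped_orbit_cvg; last exact: sg.
apply: cvgB; first exact: cvg_cst.
apply: (@cvg_dominated_dist _ _ _ (fun n => n.+1%:R^-1)); last first.
  exact: cvg_harmonic.
move=> n; have n0 : 0 < n.+1%:R :> R by [].
have -> : p n x = Num.truncn (n.+1%:R * x).
  by rewrite /p (minn_idPr _)// le_truncn// ler_pM2l.
have /truncn_itv/andP[] : 0 <= n.+1%:R * x by rewrite mulr_ge0.
set m := Num.truncn _ => ml mu'.
rewrite distrC ger0_norm; last by rewrite subr_ge0 ler_pdivrMr// mulrC.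
by rewrite lerBlDr -[X in X + _]mul1r -mulrDl ler_pdivlMr// mulrC nat1r ltW.
Qed.

Lemma duhamel_integrable D g t : measurable D -> rnorm_integrable D g ->
  rnorm_integrable D (duhamel g t).
Proof.
move=> mD ig; apply: (rnorm_integrable_le mD ig (c := M)).
  exact: strongly_borel_duhamel ig.1.
by move=> s _; exact: duhamel_bound.
Qed.

(** The excluded point s = t, where the integrand may jump, has measure 0. *)
Lemma duhamel_cvg g t (u : nat -> R) s : u @ \oo --> t -> s <> t ->
  (fun n => duhamel g (u n) s) @ \oo --> duhamel g t s.
Proof.
move=> ut st; rewrite /duhamel; case: (ltP s 0) => s0.
  rewrite memNset; last by rewrite /= in_itv/= leNgt s0.
  rewrite (_ : (fun n => _) = cst 0); first exact: cvg_cst.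
  by apply/funext => n; rewrite memNset//= in_itv/= leNgt s0.
have [{}st|ts|//] := ltgtP s t; last first.
  rewrite memNset; last by rewrite /= in_itv/= (leNgt s) ts andbF.
  have : (fun=> 0 : H) @ \oo --> (0 : H) by exact: cvg_cst.
  apply: cvg_trans; apply: near_eq_cvg.
  near=> n; have us : u n < s by near: n; exact: cvgr_lt ut _ ts.
  by rewrite memNset//= in_itv/= (leNgt s) us andbF.
rewrite mem_set; last by rewrite /= in_itv/= s0 ltW.
have : (fun n => Sp (u n - s) (g s)) @ \oo --> Sp (t - s) (g s).
  apply: clipped_orbit_cvg; last exact: cvg_cst.
  by apply: cvgB => //; exact: cvg_cst.
apply: cvg_trans; apply: near_eq_cvg.
near=> n; have us : s < u n by near: n; exact: cvgr_gt ut _ st.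
by rewrite mem_set//= in_itv/= s0 ltW.
Unshelve. all: by end_near. Qed.
End Orbits.

(** * The solution with initial value zero *)

Section Forced.
Context (R : realType) (k : scalar_kind).
Context (H : completeNormedModType (scalars R k)).
Context (dot : {dot H for @conj_scalar R k}).
Context (dot_norm : forall x : H, dot x x = `|x| ^+ 2).
Context (S : R -> H -> H) (C0S : C0_semigroup S).
Context (M : R) (M0 : 0 <= M).
Context (SM : forall t, 0 <= t -> forall x, rnorm (S t x) <= M * rnorm x).
Local Notation mu := (@lebesgue_measure R).
Local Notation rdot := (rdot dot).
Local Notation Sp := (clipped_orbit S).
Local Notation duhamel := (duhamel S).
Context (T : R) (T0 : 0 < T) (f g : R -> H).
Context (ig : forall t, rnorm_integrable `[0, t] g).
Context (gT : forall t, 0 <= t -> g (t + T) = g t).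
Context (fg : {ae mu, forall x, 0 <= x -> f x = g x}).

Definition forced (t : R) : H :=
  bochner_integral `[0, t] (fun s => S (t - s) (f s)).

Let I0 (t : R) : set (measurableTypeR R) := `[0, t]%classic.

Let mI0 t : measurable (I0 t).
Proof. exact: measurable_itv. Qed.

Let I0_fin t : (mu (I0 t) < +oo)%E.
Proof. by rewrite /I0 lebesgue_measure_itv /=; case: ifP; rewrite ?ltry. Qed.

Lemma duhamel_itv_integrable t B : rnorm_integrable (I0 B) (duhamel g t).
Proof. exact: (duhamel_integrable C0S M0 SM _ (mI0 B) (ig B)). Qed.

(** The freedom in B allows two values of [forced] to be compared over a
    common interval. *)
Lemma rf_forced t B phi C : real_functional phi C -> t <= B ->
  phi (forced t) = \int[mu]_(s in I0 B) phi (duhamel g t s).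
Proof.
move=> fphi tB.
rewrite (rf_bochner_integral dot_norm (mI0 t) (I0_fin t)
  (duhamel_itv_integrable t t) _ fphi).
  rewrite -/(I0 t) (_ : I0 t = I0 B `&` I0 t) ?Rintegral_mkcondr; last first.
    apply/esym/setIidr => s; rewrite /I0 /= !in_itv/= => /andP[-> st].
    exact: le_trans tB.
  apply: eq_Rintegral => s _; rewrite patchE.
  have [st|st] := pselect (I0 t s); first by rewrite mem_set.
  by rewrite (memNset st) /duhamel (memNset st) (rf0 fphi).
apply: (@filterS _ _ (ae_filter_ringOfSetsType mu) _ _ _ fg) => s fgs.
rewrite /I0 /= in_itv/= => /andP[s0 st].
by rewrite /duhamel mem_set /= ?in_itv/= ?s0// clipped_orbitE ?subr_ge0// fgs.
Qed.

Lemma forced_bound t B : t <= B ->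
  rnorm (forced t) <= M * \int[mu]_(s in I0 B) rnorm (g s).
Proof.
move=> tB; have int0 : 0 <= \int[mu]_(s in I0 B) rnorm (g s).
  by apply: Rintegral_ge0 => s _; exact: rnorm_ge0.
apply: (rnorm_le_rdot dot_norm); first exact: mulr_ge0.
set y := {2 3}(forced t); have fy := rdot_functional dot_norm y.
rewrite (rf_forced fy tB).
apply: (le_trans (rf_Rintegral_le (mI0 B) fy (duhamel_itv_integrable t B))).
rewrite mulrC ler_wpM2r ?rnorm_ge0// -RintegralZl//; last exact: (ig B).2.
apply: le_Rintegral => //.
- exact: (duhamel_itv_integrable t B).2.
- exact: (integrableZl (mI0 B) M (ig B).2).
- by move=> s _; exact: duhamel_bound.
Qed.

Lemma forced_dist t u B : t <= B -> u <= B ->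
  rnorm (forced t - forced u) <=
    \int[mu]_(s in I0 B) rnorm (duhamel g t s - duhamel g u s).
Proof.
move=> tB uB; apply: (rnorm_le_rdot dot_norm).
  by apply: Rintegral_ge0 => s _; exact: rnorm_ge0.
set y := _ - _; have fy := rdot_functional dot_norm y.
have -> : rdot y y = rdot (forced t) y - rdot (forced u) y := rfB fy _ _.
rewrite (rf_forced fy tB) (rf_forced fy uB).
have kt := duhamel_itv_integrable t B; have ku := duhamel_itv_integrable u B.
rewrite -RintegralB//; last 2 first.
- exact: rf_integrable fy kt.
- exact: rf_integrable fy ku.
under eq_Rintegral do rewrite -(rfB fy).
rewrite mulrC.
exact: (rf_Rintegral_le (mI0 B) fy (rnorm_integrableB (mI0 B) kt ku)).
Qed.

(** Dominated convergence, the integrands being bounded by M |g|. *)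
Lemma forced_seq_cvg (u : nat -> R) t : u @ \oo --> t ->
  (fun n => forced (u n)) @ \oo --> forced t.
Proof.
move=> ut.
have [B [uB tB]] : exists B, (forall n, u n <= B) /\ t <= B.
  have /cvg_seq_bounded/pinfty_ex_gt0[B B0 uB] : cvgn u.
    by apply/cvg_ex; exists t.
  exists (Num.max B t); split; last by rewrite le_max lexx orbT.
  by move=> n; rewrite le_max (le_trans (ler_norm _))//; apply: uB.
apply/rnorm_cvgP.
have kB n :
    rnorm_integrable (I0 B) (fun s => duhamel g (u n) s - duhamel g t s).
  by apply: rnorm_integrableB => //; exact: duhamel_itv_integrable.
have [] := @dominated_convergence _ _ _ mu (I0 B) (mI0 B)
  (fun n s => (rnorm (duhamel g (u n) s - duhamel g t s))%:E) (cst 0%E)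
  (fun s => (M + M)%:E * (rnorm (g s))%:E)%E.
- by move=> n; exact: measurable_int (kB n).2.
- exact: measurable_cst.
- exists [set t]; split; [exact: measurable_set1|exact: lebesgue_measure_set1|].
  move=> s /= nc; apply: contrapT => st; apply: nc => _.
  apply: cvg_EFin; first exact: nearW.
  by have /rnorm_cvgP := duhamel_cvg C0S M0 SM (g := g) ut st.
- exact: (integrableZl (mI0 B) (M + M) (ig B).2).
- apply: aeW => s n _; rewrite gee0_abs ?lee_fin ?rnorm_ge0//.
  rewrite (le_trans (rnormB _ _))// mulrDl.
  by apply: lerD; exact: duhamel_bound.
move=> _ _; rewrite integral0 => /fine_cvgP[_ lim0].
apply: (squeeze_cvgr _ (cvg_cst 0) lim0); apply: nearW => n /=.
by rewrite rnorm_ge0 (forced_dist (uB n) tB).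
Qed.

Lemma rdot_orbit_functional t y :
  real_functional (fun x => rdot (Sp t x) y) (rnorm y * M).
Proof.
have linS := clipped_orbit_linear C0S t; have fy := rdot_functional dot_norm y.
split=> [x z|r x|x].
- by rewrite (plain_linearD linS) (rf_add fy).
- by rewrite /real_scale (plain_linearZ linS) (rf_scale fy).
- apply: le_trans (rf_bound fy _) _; rewrite -mulrA ler_wpM2l ?rnorm_ge0//.
  exact: clipped_orbit_bound.
Qed.

(** Split the integral over [0, t + T] at T.  On [0, T] the operator S t
    factors out; the part on ]T, t + T] is translated back by T, which leaves
    g unchanged.  Both parts are compared through the functionals
    Re <x, y> and Re <S t x, y>. *)
Lemma forced_addT t : 0 <= t -> forced (t + T) = S t (forced T) + forced t.
Proof.
move=> t0; apply: (rdot_ext dot_norm) => y.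
have fy := rdot_functional dot_norm y.
rewrite (rf_add fy) -clipped_orbitE//.
rewrite (rf_forced (rdot_orbit_functional t y) (lexx T)).
rewrite (rf_forced fy (lexx t)) (rf_forced fy (lexx (t + T))).
set h := fun s => rdot (duhamel g (t + T) s) y.
have ih B : mu.-integrable (I0 B) (EFin \o h).
  exact: rf_integrable fy (duhamel_itv_integrable (t + T) B).
have := @Rintegral_itvB R h (BLeft 0) (BRight (t + T)) T (ih (t + T)).
rewrite !bnd_simp lerDr ltW// => /(_ erefl t0)/eqP; rewrite subr_eq => /eqP ->.
rewrite addrC; congr (_ + _).
  apply: eq_Rintegral => s /set_mem; rewrite /I0 /= in_itv/= => /andP[s0 sT].
  rewrite /h /duhamel !mem_set /= ?in_itv/= ?s0 ?sT//; last first.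
    by rewrite (le_trans sT)// lerDr.
  rewrite !clipped_orbitE ?subr_ge0// ?(le_trans sT) ?lerDr//.
  by rewrite -(C0_add C0S) ?subr_ge0// addrA.
have hT s : 0 < s <= t -> h (s + T) = rdot (duhamel g t s) y.
  move=> /andP[/ltW s0 st]; rewrite /h /duhamel !mem_set /= ?in_itv/= ?s0 ?st//.
    by rewrite gT// opprD addrACA subrr addr0.
  by rewrite addr_ge0 ?(ltW T0)//= lerD2r.
pose D : set (measurableTypeR R) := `]T, t + T]%classic.
have DE : shift_by T @^-1` D = `]0, t]%classic.
  apply/seteqP; split => s; rewrite /D /shift_by /= !in_itv/=.
    by move=> /andP[? ?]; apply/andP; split; lra.
  by move=> /andP[? ?]; apply/andP; split; lra.
have mD : measurable D by exact: measurable_itv.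
have it : mu.-integrable `]0, t]%classic
    (EFin \o (fun s => rdot (duhamel g t s) y)).
  apply: (integrableS (mI0 t)); [exact: measurable_itv| |].
    by move=> s; rewrite /I0 /= !in_itv/= => /andP[/ltW -> ->].
  exact: rf_integrable fy (duhamel_itv_integrable t t).
rewrite -(Rintegral_itv_obnd_cbnd it) /Rintegral; congr fine.
rewrite -(@integral_shift R T D (EFin \o h) mD); last 2 first.
- apply/measurable_EFinP.
  apply: strongly_borel_measurable (rf_lipschitz fy).
  exact: (duhamel_itv_integrable (t + T) 0).1.
- rewrite DE; apply: (eq_integrable _ _ _ _ it); first exact: measurable_itv.
  by move=> s /set_mem; rewrite /= in_itv/= => st; rewrite hT.
rewrite DE; apply: eq_integral => s /set_mem; rewrite /= in_itv/= => st.
by rewrite hT.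
Qed.

Lemma forced0 : forced 0 = 0.
Proof.
apply: (addrI (forced T)); rewrite addr0.
by have := forced_addT (lexx 0); rewrite add0r (C0_id C0S) => <-.
Qed.

Lemma forced_add_period n t : 0 <= t ->
  forced (t + T * n%:R) = S t (forced (T * n%:R)) + forced t.
Proof.
have Tn m : 0 <= T * m%:R by rewrite mulr_ge0// ltW.
elim: n => [|n IH] t0.
  by rewrite mulr0 addr0 forced0 (plain_linear0 (C0_linear C0S t0)) add0r.
rewrite -natr1 mulrDr mulr1 addrA forced_addT ?addr_ge0// IH//.
rewrite (forced_addT (Tn n)) (plain_linearD (C0_linear C0S t0)) addrA.
by rewrite (C0_add C0S).
Qed.

Lemma orbit_iter n x : S (T * n%:R) x = iter n (S T) x.
Proof.
elim: n => [|n IH]; first by rewrite mulr0 (C0_id C0S).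
have Tn : 0 <= T * n%:R by rewrite mulr_ge0// ltW.
by rewrite iterS -IH -(C0_add C0S) ?(ltW T0)// -natr1 mulrDr mulr1 addrC.
Qed.

Lemma forced_power_sum n : forced (T * n%:R) = power_sum (S T) n (forced T).
Proof.
elim: n => [|n IH]; first by rewrite mulr0 /power_sum big_nil forced0.
have Tn : 0 <= T * n%:R by rewrite mulr_ge0// ltW.
rewrite -natr1 mulrDr mulr1 forced_addT// IH orbit_iter.
by rewrite /power_sum big_nat_recr//= addrC.
Qed.
End Forced.

(** * Mild solutions *)

Lemma ereal_sup_fin_pinftyP (R : realType) (I : Type) (A : set I) (h : I -> R) :
  ereal_sup [set (h i)%:E | i in A] = +oo%E <->
  ~ exists B, forall i, A i -> h i <= B.
Proof.
split=> [supy [B hB]|nB].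
  have : (ereal_sup [set (h i)%:E | i in A] <= B%:E)%E.
    by apply: ge_ereal_sup => _ [i Ai <-]; rewrite lee_fin hB.
  by rewrite supy.
have ub i : A i -> ((h i)%:E <= ereal_sup [set (h i)%:E | i in A])%E.
  by move=> Ai; apply: ereal_sup_ubound; exists i.
case: (ereal_sup _) ub => [r|//|] ub; exfalso; apply: nB.
  by exists r => i /ub; rewrite lee_fin.
by exists 0 => i /ub; rewrite leeNy_eq.
Qed.

(** A telescoping sum. *)
Lemma power_sum_coboundary (R : realType) (k : scalar_kind)
    (H : normedModType (scalars R k)) (V : H -> H) (n : nat) (x : H) :
  linear V -> power_sum V n (x - V x) = x - iter n V x.
Proof.
move=> linV; elim: n => [|n IH].
  by rewrite /power_sum big_nil subrr.
have iterB m y z : iter m V (y - z) = iter m V y - iter m V z.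
  by elim: m => [//|m IHm]; rewrite !iterS IHm (plain_linearB linV).
rewrite /power_sum big_nat_recr//= -/(power_sum V n _) IH iterB -iterSr.
by rewrite addrA subrK.
Qed.

Section MildSolutions.
Context (R : realType) (k : scalar_kind).
Context (H : completeNormedModType (scalars R k)).
Context (dot : {dot H for @conj_scalar R k}).
Context (dot_norm : forall x : H, dot x x = `|x| ^+ 2).
Context (S : R -> H -> H) (C0S : C0_semigroup S) (bS : uniformly_bounded S).
Context (T : R) (T0 : 0 < T) (f : R -> H) (f_L1 : L1_periodic T f).

Local Notation b := (forced S f T).
Local Notation mu := (@lebesgue_measure R).

Lemma nonneg_semigroup_bound :
  exists2 M : R, 0 <= M &
    forall t, 0 <= t -> forall x, rnorm (S t x) <= M * rnorm x.
Proof.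
have [M SM] := bS; exists `|M| => // t t0 x.
by rewrite (le_trans (SM t t0 x))// ler_wpM2r ?rnorm_ge0// ler_norm.
Qed.

(** R is metrizable, so sequences suffice. *)
Lemma continuous_of_seq (u : R -> H) :
  (forall (v : nat -> R) t, v @ \oo --> t -> (u \o v) @ \oo --> u t) ->
  continuous u.
Proof.
move=> useq t; apply/rnorm_cvgP.
have [_ seqP] := @cvg_nbhsP R R^o (fun s => rnorm (u s - u t)) t 0.
apply: seqP => v vt.
by apply/rnorm_cvgP; exact: useq.
Qed.

Lemma mild_solution_exists (x : H) :
  exists u, mild_solution S f u /\
    forall t, 0 <= t -> u t = S t x + forced S f t.
Proof.
have [M M0 SM] := nonneg_semigroup_bound.
have [g [ig gT fg]] := periodic_borel_version T0 f_L1.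
pose u t := clipped_orbit S t x + forced S f t.
have uE t : 0 <= t -> u t = S t x + forced S f t.
  by move=> t0; rewrite /u clipped_orbitE.
exists u; split => //; split; last by exists x.
apply: continuous_subspaceT; apply: continuous_of_seq => v t vt.
apply: cvgD.
  by apply: (clipped_orbit_cvg C0S M0 SM) => //; exact: cvg_cst.
exact: (forced_seq_cvg dot_norm C0S M0 SM ig fg).
Qed.

(** At t = r + n T the solution is S t u0 + S r applied to the n-th power
    sum + F r, and |F r| is at most M times the integral of |g| over one
    period. *)
Lemma mild_solution_bounded u B : mild_solution S f u ->
  (forall n, rnorm (power_sum (S T) n b) <= B) ->
  exists C, forall t, 0 <= t -> rnorm (u t) <= C.
Proof.
move=> [_ [u0 uE]] bB.
have [M M0 SM] := nonneg_semigroup_bound.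
have [g [ig gT fg]] := periodic_borel_version T0 f_L1.
exists (M * rnorm u0 + (M * B + M * \int[mu]_(s in `[0, T]) rnorm (g s))).
move=> t t0.
rewrite uE// (le_trans (rnormD _ _))// lerD ?SM//.
have /andP[r0 rT] := period_remP T0 t0.
rewrite -(subrK (T * (period_index T t)%:R) t) -/(period_rem T t).
rewrite -/(forced S f _).
rewrite (forced_add_period dot_norm C0S M0 SM T0 ig gT fg)//.
rewrite (le_trans (rnormD _ _))// lerD//.
  rewrite (le_trans (SM _ r0 _))// ler_wpM2l//.
  by rewrite (forced_power_sum dot_norm C0S M0 SM T0 ig gT fg).
exact: (forced_bound dot_norm C0S M0 SM ig fg (ltW rT)).
Qed.

(** The n-th power sum is u (n T) - S (n T) u0. *)
Lemma bounded_mild_solution_power_sum u C : mild_solution S f u ->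
  (forall t, 0 <= t -> rnorm (u t) <= C) ->
  exists B, forall n, rnorm (power_sum (S T) n b) <= B.
Proof.
move=> [_ [u0 uE]] uC.
have [M M0 SM] := nonneg_semigroup_bound.
have [g [ig gT fg]] := periodic_borel_version T0 f_L1.
exists (C + M * rnorm u0) => n.
have Tn : 0 <= T * n%:R by rewrite mulr_ge0// ltW.
rewrite -(forced_power_sum dot_norm C0S M0 SM T0 ig gT fg).
have -> : forced S f (T * n%:R) = u (T * n%:R) - S (T * n%:R) u0.
  by rewrite uE// addrC addKr.
by rewrite (le_trans (rnormB _ _))// lerD ?uC ?SM.
Qed.

Lemma range_power_sum_bounded :
  (exists x, x - S T x = b) ->
  exists B, forall n, rnorm (power_sum (S T) n b) <= B.
Proof.
move=> [x <-]; have [M M0 SM] := nonneg_semigroup_bound.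
exists (rnorm x + M * rnorm x) => n.
rewrite power_sum_coboundary; last exact: C0_linear C0S _ (ltW T0).
rewrite -(orbit_iter C0S T0) (le_trans (rnormB _ _))// lerD ?SM//.
by rewrite mulr_ge0// ltW.
Qed.

Lemma power_sum_bounded_range B :
  (forall n, rnorm (power_sum (S T) n b) <= B) -> exists x, x - S T x = b.
Proof.
apply: (bounded_power_sum_range dot_norm).
- exact: C0_linear C0S _ (ltW T0).
- exact: C0_continuous C0S _ (ltW T0).
Qed.

Lemma periodic_mild_solutionP :
  (exists u, mild_solution S f u /\ periodic_on_halfline T u) <->
  exists x, x - S T x = b.
Proof.
have [M M0 SM] := nonneg_semigroup_bound.
have [g [ig gT fg]] := periodic_borel_version T0 f_L1.
split=> [[u [[_ [u0 uE]] uT]]|[x xb]].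
  exists u0; have := uT 0 (lexx 0); rewrite add0r !uE ?(ltW T0)//.
  rewrite -!/(forced S f _) (forced0 dot_norm C0S M0 SM T0 ig gT fg).
  by rewrite (C0_id C0S) addr0 => uu; rewrite -[X in X - _]uu addrC addKr.
have [u [mu_ uE]] := mild_solution_exists x.
exists u; split=> // t t0.
rewrite !uE ?addr_ge0 ?(ltW T0)//.
rewrite (forced_addT dot_norm C0S M0 SM T0 ig gT fg)// addrA; congr (_ + _).
rewrite (C0_add C0S) ?(ltW T0)// -(plain_linearD (C0_linear C0S t0)).
by rewrite -xb addrC subrK.
Qed.
End MildSolutions.

Theorem theorem2p7 (R : realType) (k : scalar_kind)
    (H : completeNormedModType (scalars R k))
    (dot : {dot H for @conj_scalar R k})
    (dot_norm : forall x : H, dot x x = `|x| ^+ 2)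
    (domA : set H) (A : H -> H) (S : R -> H -> H)
    (semigroup_S : C0_semigroup S)
    (generator_A : generator S domA A)
    (bounded_S : uniformly_bounded S)
    (T : R) (T_gt0 : 0 < T)
    (f : R -> H) (f_L1 : L1_periodic T f) :
  let V := S T in
  let b := bochner_integral `[0, T] (fun s => S (T - s) (f s)) in
  [<-> ~ exists u, mild_solution S f u /\ periodic_on_halfline T u;
       forall u, mild_solution S f u -> unbounded_on_halfline u;
       exists u, mild_solution S f u /\ unbounded_on_halfline u;
       ~ range (fun x => x - V x) b;
       ereal_sup [set (rnorm (power_sum V n b))%:E | n in [set n | (1 <= n)%N]]
         = +oo%E]
  /\ (statically_resonant S T f <-> secularly_resonant S f).
Proof.
move=> V b.
have unbP u : unbounded_on_halfline u <->
    ~ exists C, forall t, 0 <= t -> rnorm (u t) <= C.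
  rewrite /unbounded_on_halfline ereal_sup_fin_pinftyP.
  split=> nB [C uC]; apply: nB; exists C => t; have := uC t;
    by rewrite /= in_itv/= andbT.
have rangeP : range (fun x => x - V x) b <-> exists x, x - V x = b.
  by split=> [[x _]|[x xb]]; exists x.
have supP :
    ereal_sup [set (rnorm (power_sum V n b))%:E | n in [set n | (1 <= n)%N]]
    = +oo%E <-> ~ exists B, forall n, rnorm (power_sum V n b) <= B.
  rewrite ereal_sup_fin_pinftyP.
  split=> nB [B bB]; apply: nB; exists B => n //=.
  case: n => [|n]; last exact: bB.
  by rewrite /power_sum big_nil rnorm0 (le_trans (rnorm_ge0 _) (bB 1%N _)).
have perP := periodic_mild_solutionP dot_norm semigroup_S bounded_S T_gt0 f_L1.
have boundedP := power_sum_bounded_range dot_norm semigroup_S T_gt0 (f := f).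
have solB := mild_solution_bounded dot_norm semigroup_S bounded_S T_gt0 f_L1.
have tfa : [<-> ~ exists u, mild_solution S f u /\ periodic_on_halfline T u;
       forall u, mild_solution S f u -> unbounded_on_halfline u;
       exists u, mild_solution S f u /\ unbounded_on_halfline u;
       ~ range (fun x => x - V x) b;
       ereal_sup [set (rnorm (power_sum V n b))%:E | n in [set n | (1 <= n)%N]]
         = +oo%E].
  tfae.
  - move=> noper u su; apply/unbP => -[C uC]; apply: noper; apply/perP.
    have [B bB] := bounded_mild_solution_power_sum dot_norm semigroup_S
      bounded_S T_gt0 f_L1 su uC.
    exact: boundedP bB.
  - move=> allunb.
    have [u [su _]] := mild_solution_exists dot_norm semigroup_S bounded_S
      T_gt0 f_L1 0.
    by exists u; split => //; exact: allunb.
  - move=> [u [su /unbP nbu]] /rangeP rb; apply: nbu.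
    have [B bB] := range_power_sum_bounded semigroup_S bounded_S T_gt0 rb.
    exact: solB su bB.
  - move=> nrb; apply/supP => -[B bB]; apply: nrb; apply/rangeP.
    exact: boundedP bB.
  - move=> /supP nB /perP rb; apply: nB.
    exact: (range_power_sum_bounded semigroup_S bounded_S T_gt0 rb).
split => //; exact: (tfa 0%N 2%N).
Qed.
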